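(* Let $M^n$ be a simply connected smooth manifold, $n\ge3$. (i) Let $(M,g,S,t)$ and $(M,g',S',t')$ be two conformally equivalent abundant manifolds. Then the associated abundant hypersurface normalisations are conformally equivalent (after applying an affine transformation of $\mathbb{R}^{n+1}$ to one of them so that the immersions agree). (ii) Let $(f:M\to\mathbb{R}^{n+1},\Xi)$ and $(f,\Xi')$ be two conformally equivalent abundant hypersurface co-normalisations. Then the associated abundant manifolds are conformally equivalent (for a suitable choice of the additive constants in their functions $t,t'$).
   Context: All manifolds are smooth, connected and oriented. **Hypersurfaces.** Let $\bar\nabla$ be the standard flat connection on $\mathbb{R}^{n+1}$. An affine hypersurface normalisation $(f,\xi)$ is an immersion $f:M^n\to\mathbb{R}^{n+1}$ with a transversal field $\xi:M\to\mathbb{R}^{n+1}$. Suppressing $f$, one decomposes $\bar\nabla_XY=\nabla_XY+G(X,Y)\xi$, $\bar\nabla_X\xi=-\hat A(X)+\Theta(X)\xi$, where $\nabla$ is the induced torsion-free connection. It is non-degenerate if $G$ is non-degenerate (always assumed) and relative if $\Theta=0$. $G$ is the associated (pseudo-Riemannian) metric with Levi-Civita connection $\nabla^G$; $C(X,Y,Z)=G(\nabla_XY-\nabla^G_XY,Z)$ is the associated cubic, totally symmetric for relative normalisations. In that case put $u=\frac1{n+2}\mathrm{tr}_GC$ and $C(X,Y,Z)=U(X,Y,Z)+u(X)G(Y,Z)+u(Y)G(X,Z)+u(Z)G(X,Y)$ with $U$ totally symmetric and $G$-trace-free. A co-normal field is a nowhere vanishing section $\Xi$ of the annihilator of $f_*TM$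 in $f^*T^*\mathbb{R}^{n+1}$. It determines a unique transversal field $\xi$ with $\langle\Xi,\xi\rangle=1$, $\langle\bar\nabla_X\Xi,\xi\rangle=0$ for all $X$; then $(f,\xi)$ is relative, $(f,\Xi)$ is called the dual relative co-normalisation, and its associated metric, cubic, etc. are those of $(f,\xi)$. Two relative co-normalisations $(f,\Xi)$, $(f,\Xi')$ of the same immersion (equivalently their dual normalisations) are conformally equivalent if $\Xi'=\Omega^2\Xi$ for a nowhere vanishing smooth function $\Omega$. **Abundant manifold ($n\ge3$).** $(M,g,S,t)$ with $(M,g)$ a conformally flat (pseudo-)Riemannian manifold of dimension $n\geq3$, $S$ a totally symmetric trace-free $(0,3)$-tensor field and $t$ a smooth function. Define $S_X\in\mathrm{End}(TM)$ by $g(S_XY,Z)=S(X,Y,Z)$, $\hat S(X,Y)=S_XY$, $\mathscr S(X,Y)=\mathrm{tr}(S_XS_Y)$, $|S|_g^2=\mathrm{tr}_g\mathscr S$, and the Schouten tensor $\mathsf P^g=\frac1{n-2}\big(\mathrm{Ric}^g-\frac{\mathrm{tr}_g\mathrm{Ric}^g}{2(n-1)}g\big)$. The conditions are: (a) $(\nabla^g)^2t=3\mathsf P^g+\frac13\big(dt\otimes dt-\frac12|\mathrm{grad}\,t|_g^2g\big)+\frac1{3(n-2)}\Big(\mathscr S+\frac{(n-6)|S|_g^2}{2(n-1)(n+2)}g\Big)$; (b) $(\nabla^g_WS)(X,Y,Z)=\frac13(\Pi_{\mathrm{Sym}^3_0}S_1)(X,Y,Z,W)$, where $S_1(X,Y,Z,W)=g(S_XS_YZ,W)+3S(X,Y,W)dt(Z)+S(X,Y,Z)dt(W)+\big(\frac4{n-2}\mathscr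 S(Y,Z)-3S(Y,Z,\mathrm{grad}_gt)\big)g(X,W)$ and $\Pi_{\mathrm{Sym}^3_0}$ is the projection onto the totally symmetric trace-free part in the first three arguments; (c) the algebraic curvature tensor $B_1(X,Y,Z,W)=\frac12\big(g(S_XZ,S_YW)-g(S_XW,S_YZ)\big)$ has vanishing totally trace-free (Weyl) part. Abundant manifolds $(M,g,S,t)$ and $(M,g',S',t')$ are conformally equivalent if $g'=\Omega^2g$, $\hat S'=\hat S$, $t'=t-3\ln|\Omega|$ for some nowhere vanishing $\Omega\in C^\infty(M)$, where $\hat S'$ is formed with $g'$. **Abundant hypersurface (co-)normalisation ($n\ge3$).** A relative non-degenerate co-normalisation $(f,\Xi)$ (or its dual normalisation $(f,\xi)$) of $f:M^n\to\mathbb{R}^{n+1}$ such that $(M,G)$ is Weyl flat (its conformal Weyl tensor vanishes) and $\Pi_{\mathrm{Sym}^4_0}(\nabla^GU)=\Pi_{\mathrm{Sym}^4_0}[\mathfrak U+4\,U\otimes u]$, $\nabla^Gu=\mathsf P^G+u\otimes u-\frac{|u|^2}2G+\frac1{n-2}\Big(\mathscr U+\frac{n-6}{2(n+2)(n-1)}|U|^2G\Big)$, where $G(U_XY,Z)=U(X,Y,Z)$, $\mathscr U(X,Y)=\mathrm{tr}(U_XU_Y)$, $|U|^2=\mathrm{tr}_G\mathscr U$, $\mathfrak U(X,Y,Z,W)=G(U_XU_YW,Z)$, $\mathsf P^G$ is the Schouten tensor of $G$, and $\Pi_{\mathrm{Sym}^4_0}$ is the projection onto totally symmetric, $G$-trace-free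 $(0,4)$-tensors. **Association.** For simply connected $M$, the abundant hypersurface (co-)normalisation associated to $(M,g,S,t)$ is the one, unique up to affine transformations of $\mathbb{R}^{n+1}$, with $G=g$, $U=\frac13S$, $u=\frac13dt$. Conversely, the abundant manifold associated to $(f,\Xi)$ is $(M,G,3U,t)$ with $dt=3u$ ($t$ being determined up to an additive constant). *)

(* Defs.v *)
From HB Require Import structures.
From mathcomp Require Import all_boot all_order all_algebra.
From mathcomp Require Import all_classical all_reals all_analysis.

Set Implicit Arguments.
Unset Strict Implicit.
Unset Printing Implicit Defensive.

Import Order.TTheory GRing.Theory Num.Theory.
Import numFieldNormedType.Exports.

Local Open Scope classical_set_scope.
Local Open Scope ring_scope.

(* Points of R^n and of R^(n+1) are row vectors, covectors of R^(n+1) are column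
   vectors; <Xi, v> is the 1 x 1 matrix v *m Xi. *)

Section Smoothness.
Context {R : realType} {n : nat}.
Implicit Types (W : normedModType R) (V : set 'rV[R]_n).

Definition pder W (i : 'I_n) (h : 'rV[R]_n -> W) : 'rV[R]_n -> W :=
  fun x => 'D_(delta_mx 0 i) h x.

(* C^oo on V, for V open: all iterated partial derivatives are differentiable. *)
Definition smooth_on W V (h : 'rV[R]_n -> W) : Prop :=
  forall (s : seq 'I_n) (x : 'rV[R]_n), V x ->
    differentiable (foldr (fun i k => pder i k) h s) x.

End Smoothness.

Section Manifolds.
Context {R : realType}.

(* Only the values of [coord] on [dom], and of [param] on [chart_range], matter. *)
Record chart (n : nat) (M : topologicalType) := Chart {
  dom : set M;
  coord : M -> 'rV[R]_n;
  param : 'rV[R]_n -> M }.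

Definition chart_range n M (c : chart n M) : set 'rV[R]_n := coord c @` dom c.

Record is_chart n M (c : chart n M) : Prop := IsChart {
  chart_dom_open : open (dom c);
  chart_range_open : open (chart_range c);
  chart_coord_cont : {within dom c, continuous (coord c)};
  chart_param_cont : {within chart_range c, continuous (param c)};
  chart_coordK : forall p, dom c p -> param c (coord c p) = p }.

(* Row i of the Jacobian ['J F x] is the i-th partial derivative of F at x. *)
Record oriented_compatible n M (c c' : chart n M) : Prop := OrientedCompatible {
  transition_smooth :
    smooth_on (coord c' @` (dom c `&` dom c')) (coord c \o param c');
  transition_oriented : forall p, dom c p -> dom c' p ->
    0 < \det ('J (coord c \o param c') (coord c' p)) }.

(* Smooth, connected, oriented manifold of dimension n; the oriented smooth
   structure is given by an atlas, which need not be maximal. *)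
Record manifold (n : nat) := Manifold {
  carrier :> topologicalType;
  atlas : set (chart n carrier);
  manifold_hausdorff : hausdorff_space carrier;
  manifold_second_countable : @second_countable carrier;
  manifold_connected : connected [set: carrier];
  atlas_charts : forall c, atlas c -> is_chart c;
  atlas_cover : forall p, exists2 c, atlas c & dom c p;
  atlas_compatible : forall c c', atlas c -> atlas c' ->
    oriented_compatible c c' }.

Let unit_itv : set R := `[0, 1].

Definition simply_connected (M : topologicalType) : Prop :=
  (forall p q : M, exists gamma : R -> M,
     [/\ {within unit_itv, continuous gamma}, gamma 0 = p & gamma 1 = q]) /\
  (forall gamma : R -> M, {within unit_itv, continuous gamma} -> gamma 0 = gamma 1 ->
     exists H : R * R -> M,
       [/\ {within unit_itv `*` unit_itv, continuous H},
           (forall s, unit_itv s -> H (0, s) = gamma s),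
           (forall s, unit_itv s -> H (1, s) = gamma 0) &
           (forall r, unit_itv r -> H (r, 0) = gamma 0 /\ H (r, 1) = gamma 0)]).

Definition smooth_map n (M : manifold n) (W : normedModType R) (h : M -> W) :=
  forall c, atlas c -> smooth_on (chart_range c) (h \o param c).

End Manifolds.

Arguments chart R n M : clear implicits.
Arguments manifold R n : clear implicits.
Arguments simply_connected R M : clear implicits.

(* Tensors at a point are given by their components in a frame, with a
   nondegenerate symmetric matrix g. *)
Section PointwiseAlgebra.
Context {R : realType} {n : nat}.
Implicit Types (g h : 'M[R]_n) (v : 'I_n -> R).

Definition tensor3 := 'I_n -> 'I_n -> 'I_n -> R.
Definition tensor4 := 'I_n -> 'I_n -> 'I_n -> 'I_n -> R.
Implicit Types (T S : tensor3) (B Q : tensor4).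

Definition tr2 g h : R := \sum_i \sum_j invmx g i j * h i j.
Definition sharp g v (k : 'I_n) : R := \sum_l invmx g k l * v l.
Definition normsq g v : R := \sum_i sharp g v i * v i.

(* k-th component of S_(e_i) e_j *)
Definition hat g S : tensor3 := fun i j k => \sum_l S i j l * invmx g l k.

(* tr (S_(e_i) S_(e_j)) *)
Definition scr g S : 'M[R]_n :=
  \matrix_(i, j) \sum_a \sum_b hat g S i a b * hat g S j b a.
Definition cubic_normsq g S : R := tr2 g (scr g S).

(* g (S_(e_i) S_(e_j) e_k, e_l) *)
Definition comp2 g S : tensor4 :=
  fun i j k l => \sum_a hat g S j k a * S i a l.

Definition totally_symmetric T : Prop :=
  forall i j k, T i j k = T j i k /\ T i j k = T i k j.
Definition trace_free g T : Prop :=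
  forall k, \sum_i \sum_j invmx g i j * T i j k = 0.

Definition sym3 T : tensor3 := fun i j k =>
  6^-1 * (T i j k + T j k i + T k i j + T j i k + T i k j + T k j i).

(* For symmetric T, the coefficient makes the result trace-free; same for tf4. *)
Definition tf3 g T : tensor3 :=
  let tau k := \sum_a \sum_b invmx g a b * T a b k in
  fun i j k => T i j k
    - (n%:R + 2)^-1 * (g i j * tau k + g j k * tau i + g i k * tau j).

Definition proj_sym30 g Q : tensor4 :=
  fun i j k l => tf3 g (sym3 (fun a b c => Q a b c l)) i j k.

Definition sym4 Q : tensor4 :=
  let Q3 l := sym3 (fun a b c => Q a b c l) in
  fun i j k l => 4^-1 * (Q3 l i j k + Q3 k i j l + Q3 j i k l + Q3 i j k l).

Definition tf4 g Q : tensor4 :=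
  let tau k l := \sum_a \sum_b invmx g a b * Q a b k l in
  let sigma := \sum_a \sum_b invmx g a b * tau a b in
  fun i j k l => Q i j k l
    - (n%:R + 4)^-1 *
        (g i j * tau k l + g i k * tau j l + g i l * tau j k
         + g j k * tau i l + g j l * tau i k + g k l * tau i j)
    + ((n%:R + 2) * (n%:R + 4))^-1 * sigma *
        (g i j * g k l + g i k * g j l + g i l * g j k).

Definition proj_sym40 g Q : tensor4 := tf4 g (sym4 Q).

(* Algebraic curvature tensors are normalised so that the Ricci contraction is
   over the slots 1 and 3: B(X, Y, Z, W) = g (R(X, Y) W, Z). *)
Definition ricci g B : 'M[R]_n :=
  \matrix_(j, l) \sum_i \sum_k invmx g i k * B i j k l.
Definition schouten g B : 'M[R]_n :=
  (n%:R - 2)^-1 *: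
    (ricci g B - (tr2 g (ricci g B) / (2 * (n%:R - 1))) *: g).

(* totally trace-free part *)
Definition weyl_part g B : tensor4 :=
  let P := schouten g B in
  fun i j k l => B i j k l
    - (g i k * P j l + g j l * P i k - g i l * P j k - g j k * P i l).

End PointwiseAlgebra.

Arguments tensor3 : clear implicits.
Arguments tensor4 : clear implicits.

(* Calculus with component functions on an open subset of R^n. *)
Section LocalGeometry.
Context {R : realType} {n : nat}.
Implicit Types (g : 'rV[R]_n -> 'M[R]_n) (x : 'rV[R]_n).

(* k-th component of the Levi-Civita derivative of e_j along e_i *)
Definition christoffel g x : tensor3 R n := fun i j k =>
  2^-1 * \sum_l invmx (g x) k l *
    (pder i (fun y => g y j l) x + pder j (fun y => g y i l) x
     - pder l (fun y => g y i j) x).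

(* a-th component of R(e_i, e_j) e_l, R(X,Y) = [nabla_X, nabla_Y] - nabla_[X,Y] *)
Definition curvature_op g x : tensor4 R n := fun i j l a =>
  pder i (fun y => christoffel g y j l a) x
  - pder j (fun y => christoffel g y i l a) x
  + \sum_m (christoffel g x i m a * christoffel g x j l m
            - christoffel g x j m a * christoffel g x i l m).

Definition riemann g x : tensor4 R n := fun i j k l =>
  \sum_a g x k a * curvature_op g x i j l a.

(* (i, j) entry: (nabla_(e_i) v)(e_j) *)
Definition nabla1 g (v : 'rV[R]_n -> 'I_n -> R) x : 'M[R]_n :=
  \matrix_(i, j) (pder i (fun y => v y j) x
                  - \sum_a christoffel g x i j a * v x a).

(* (nabla_(e_l) T)(e_i, e_j, e_k) *)
Definition nabla3 g (T : 'rV[R]_n -> tensor3 R n) x : tensor4 R n :=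
  fun i j k l => pder l (fun y => T y i j k) x
    - \sum_a (christoffel g x l i a * T x a j k
              + christoffel g x l j a * T x i a k
              + christoffel g x l k a * T x i j a).

Definition grad_form (h : 'rV[R]_n -> R) x (i : 'I_n) : R := pder i h x.

End LocalGeometry.

Section AbundantManifolds.
Context {R : realType} {n : nat}.
Variable M : manifold R n.

(* Tensor fields on M are families of components, one for each chart and each
   point of its range, subject to the tensor transformation law. *)
Record structure_data := StructureData {
  metric : chart R n M -> 'rV[R]_n -> 'M[R]_n;
  cubic : chart R n M -> 'rV[R]_n -> tensor3 R n;
  potential : M -> R }.

Definition is_tensor2 (g : chart R n M -> 'rV[R]_n -> 'M[R]_n) : Prop :=
  forall c c', atlas c -> atlas c' -> forall p, dom c p -> dom c' p ->
    let J := 'J (coord c \o param c') (coord c' p) in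
    g c' (coord c' p) = J *m g c (coord c p) *m J^T.

Definition is_tensor3 (S : chart R n M -> 'rV[R]_n -> tensor3 R n) : Prop :=
  forall c c', atlas c -> atlas c' -> forall p, dom c p -> dom c' p ->
    let J := 'J (coord c \o param c') (coord c' p) in
    forall i j k, S c' (coord c' p) i j k =
      \sum_a \sum_b \sum_d J i a * J j b * J k d * S c (coord c p) a b d.

Definition is_metric (g : chart R n M -> 'rV[R]_n -> 'M[R]_n) : Prop :=
  is_tensor2 g /\
  forall c, atlas c -> smooth_on (chart_range c) (g c) /\
    forall x, chart_range c x -> (g c x)^T = g c x /\ g c x \in unitmx.

Definition is_tracefree_cubic (g : chart R n M -> 'rV[R]_n -> 'M[R]_n)
    (S : chart R n M -> 'rV[R]_n -> tensor3 R n) : Prop :=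
  is_tensor3 S /\
  forall c, atlas c ->
    (forall i j k, smooth_on (chart_range c) (fun x => S c x i j k)) /\
    forall x, chart_range c x ->
      totally_symmetric (S c x) /\ trace_free (g c x) (S c x).

(* Locally, some positive multiple of g is flat. *)
Definition conformally_flat (g : chart R n M -> 'rV[R]_n -> 'M[R]_n) : Prop :=
  forall c, atlas c -> forall x, chart_range c x ->
    exists (V : set 'rV[R]_n) (lambda : 'rV[R]_n -> R),
      [/\ open V, V x, V `<=` chart_range c, smooth_on V lambda &
          forall y, V y -> 0 < lambda y /\
            forall i j k l,
              riemann (fun z => lambda z *: g c z) y i j k l = 0].

Definition S1 (g : 'M[R]_n) (S : tensor3 R n) (dt : 'I_n -> R) : tensor4 R n :=
  fun i j k l =>
    comp2 g S i j k l + 3 * S i j l * dt k + S i j k * dt l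
    + (4 / (n%:R - 2) * scr g S j k - 3 * \sum_a S j k a * sharp g dt a)
      * g i l.

Definition B1 (g : 'M[R]_n) (S : tensor3 R n) : tensor4 R n :=
  fun i j k l =>
    let ip a b a' b' := \sum_p \sum_q hat g S a b p * g p q * hat g S a' b' q in
    2^-1 * (ip i k j l - ip i l j k).

Record is_abundant_manifold (D : structure_data) : Prop := IsAbundantManifold {
  am_metric : is_metric (metric D);
  am_cubic : is_tracefree_cubic (metric D) (cubic D);
  am_potential : smooth_map (potential D);
  am_flat : conformally_flat (metric D);
  am_hessian : forall c, atlas c -> forall x, chart_range c x ->
    let g := metric D c in
    let S := cubic D c x in
    let dt := grad_form (potential D \o param c) in
    nabla1 g dt x =
      3 *: schouten (g x) (riemann g x)
      + 3^-1 *: ((\matrix_(i, j) (dt x i * dt x j))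
                 - (2^-1 * normsq (g x) (dt x)) *: g x)
      + (3 * (n%:R - 2))^-1 *:
          (scr (g x) S
           + ((n%:R - 6) * cubic_normsq (g x) S
              / (2 * (n%:R - 1) * (n%:R + 2))) *: g x);
  am_nablaS : forall c, atlas c -> forall x, chart_range c x ->
    let g := metric D c in
    let dt := grad_form (potential D \o param c) in
    forall i j k l,
      nabla3 g (cubic D c) x i j k l =
        3^-1 * proj_sym30 (g x) (S1 (g x) (cubic D c x) (dt x)) i j k l;
  am_weyl : forall c, atlas c -> forall x, chart_range c x ->
    let g := metric D c x in
    forall i j k l, weyl_part g (B1 g (cubic D c x)) i j k l = 0 }.

Definition abundant_conformal (D D' : structure_data) : Prop :=
  exists Omega : M -> R,
    [/\ smooth_map Omega, (forall p, Omega p != 0),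
        (forall c, atlas c -> forall x, chart_range c x ->
           metric D' c x = Omega (param c x) ^+ 2 *: metric D c x),
        (forall c, atlas c -> forall x, chart_range c x -> forall i j k,
           hat (metric D' c x) (cubic D' c x) i j k =
           hat (metric D c x) (cubic D c x) i j k) &
        (forall p, potential D' p = potential D p - 3 * ln `|Omega p|)].

Definition shift_potential (D : structure_data) (a : R) : structure_data :=
  StructureData (metric D) (cubic D) (fun p => potential D p + a).

End AbundantManifolds.

Section Hypersurfaces.
Context {R : realType} {n : nat}.
Variable M : manifold R n.

(* An immersion together with a co-normal field and its dual transversal
   field; (immersion, transversal) is the dual normalisation. *)
Record conormalisation := Conormalisation {
  immersion : M -> 'rV[R]_(n + 1);
  conormal : M -> 'cV[R]_(n + 1);
  transversal : M -> 'rV[R]_(n + 1) }.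

Section Invariants.
Variables (H : conormalisation) (c : chart R n M).
Implicit Type x : 'rV[R]_n.

Let f := immersion H \o param c.
Let xi := transversal H \o param c.

(* rows: the coordinate vectors of M pushed forward by the immersion, then xi *)
Definition frame x : 'M[R]_(n + 1) := col_mx ('J f x) (xi x).

(* Coefficients in this frame of the flat derivative of e_j along e_i: the
   first n give the induced connection, the last one the associated metric. *)
Definition gauss x (i j : 'I_n) : 'rV[R]_(n + 1) :=
  pder i (pder j f) x *m invmx (frame x).

Definition induced_connection x : tensor3 R n :=
  fun i j k => lsubmx (gauss x i j) 0 k.

Definition assoc_G x : 'M[R]_n := \matrix_(i, j) rsubmx (gauss x i j) 0 0.

Definition assoc_C x : tensor3 R n := fun i j k =>
  \sum_l (induced_connection x i j l - christoffel assoc_G x i j l) * assoc_G x l k.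

Definition assoc_u x (k : 'I_n) : R :=
  (n%:R + 2)^-1 * \sum_i \sum_j invmx (assoc_G x) i j * assoc_C x i j k.

Definition assoc_U x : tensor3 R n := fun i j k =>
  assoc_C x i j k
  - (assoc_u x i * assoc_G x j k + assoc_u x j * assoc_G x i k
     + assoc_u x k * assoc_G x i j).

End Invariants.

(* [transversal H] is pinned down by the equations [rc_dual_normalised] and
   [rc_dual_relative], which also make the dual normalisation relative. *)
Record is_relative_conormalisation (H : conormalisation) : Prop :=
  IsRelativeConormalisation {
    rc_immersion_smooth : smooth_map (immersion H);
    rc_conormal_smooth : smooth_map (conormal H);
    rc_transversal_smooth : smooth_map (transversal H);
    rc_immersion : forall c, atlas c -> forall x, chart_range c x ->
      \rank ('J (immersion H \o param c) x) = n;
    rc_conormal_neq0 : forall p, conormal H p != 0;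
    rc_annihilates : forall c, atlas c -> forall x, chart_range c x ->
      'J (immersion H \o param c) x *m conormal H (param c x) = 0;
    rc_dual_normalised : forall p, transversal H p *m conormal H p = 1%:M;
    rc_dual_relative : forall c, atlas c -> forall x, chart_range c x -> forall i,
      transversal H (param c x) *m pder i (conormal H \o param c) x = 0;
    rc_nondegenerate : forall c, atlas c -> forall x, chart_range c x ->
      assoc_G H c x \in unitmx }.

Record is_abundant_conormalisation (H : conormalisation) : Prop :=
  IsAbundantConormalisation {
    ac_relative : is_relative_conormalisation H;
    ac_weyl_flat : forall c, atlas c -> forall x, chart_range c x ->
      forall i j k l,
        weyl_part (assoc_G H c x) (riemann (assoc_G H c) x) i j k l = 0;
    ac_nablaU : forall c, atlas c -> forall x, chart_range c x ->
      let G := assoc_G H c in let U := assoc_U H c in let u := assoc_u H c in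
      forall i j k l,
        proj_sym40 (G x) (nabla3 G U x) i j k l =
        proj_sym40 (G x)
          (fun a b d e => comp2 (G x) (U x) a b e d + 4 * U x a b d * u x e)
          i j k l;
    ac_nablau : forall c, atlas c -> forall x, chart_range c x ->
      let G := assoc_G H c in let U := assoc_U H c x in let u := assoc_u H c in
      nabla1 G u x =
        schouten (G x) (riemann G x)
        + (\matrix_(i, j) (u x i * u x j)) - (normsq (G x) (u x) / 2) *: G x
        + (n%:R - 2)^-1 *:
            (scr (G x) U
             + ((n%:R - 6) / (2 * (n%:R + 2) * (n%:R - 1))
                * cubic_normsq (G x) U) *: G x) }.

Definition conormal_conformal (H H' : conormalisation) : Prop :=
  (forall p, immersion H' p = immersion H p) /\
  exists Omega : M -> R,
    [/\ smooth_map Omega, (forall p, Omega p != 0) &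
        forall p, conormal H' p = Omega p ^+ 2 *: conormal H p].

(* Image of H under the affine transformation v |-> v *m A + b. *)
Definition affine_image (A : 'M[R]_(n + 1)) (b : 'rV[R]_(n + 1))
    (H : conormalisation) : conormalisation :=
  Conormalisation
    (fun p => immersion H p *m A + b)
    (fun p => invmx A *m conormal H p)
    (fun p => transversal H p *m A).

Definition associated (D : structure_data M) (H : conormalisation) : Prop :=
  smooth_map (potential D) /\
  forall c, atlas c -> forall x, chart_range c x ->
    [/\ assoc_G H c x = metric D c x,
        (forall i j k, assoc_U H c x i j k = 3^-1 * cubic D c x i j k) &
        (forall i, assoc_u H c x i = 3^-1 * grad_form (potential D \o param c) x i)].

End Hypersurfaces.

(* Main.v *)
From mathcomp Require Import all_boot all_order all_algebra.
From mathcomp Require Import all_classical all_reals all_analysis.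
From mathcomp Require Import ring lra.
Require Import Defs.

Set Implicit Arguments.
Unset Strict Implicit.
Unset Printing Implicit Defensive.

Import Order.TTheory GRing.Theory Num.Theory.
Import numFieldNormedType.Exports.

Local Open Scope classical_set_scope.
Local Open Scope ring_scope.

(** Why the theorem holds.  Fix a chart and write [f_i], [f_ij] for the partial
    derivatives of the immersion.  The metric and the cubic form of a relative
    co-normalisation [(f, Xi)] can be read off from the pair [(f, Xi)] alone:
    [G_ij = <Xi, f_ij>] and [C_ijk = - <d_k Xi, f_ij> - [ij, k]], where
    [[ij, k]] are the Christoffel symbols of the first kind of [G]
    ([assoc_GE], [assoc_CE]).  Hence a change [Xi' = phi Xi], with
    [phi = Omega^2], gives [G' = phi G] and
    [C' = phi C - 1/2 (phi_i G_jk + phi_j G_ik + phi_k G_ij)]; the trace and the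
    trace-free part of this identity are [u' = u - d ln |Omega|] and
    [U' = phi U] ([conformal_assoc_u], [conformal_assoc_U]).  With one index
    raised, [U] is therefore unchanged, and [d t = 3 u] shows that
    [t' - t + 3 ln |Omega|] has vanishing gradient, so it is a constant: this is
    the second assertion.

    For the first assertion the computation runs backwards: conformal data force
    [<Xi', f'_ij> = <phi Xi, f_ij>] and
    [<d_k Xi', f'_ij> = <d_k (phi Xi), f_ij>] ([conformal_data_third_form]).  Let
    [K'] and [Z] be the square matrices whose columns are the partial derivatives
    of the co-normal followed by the co-normal itself, for [Xi'] and [phi Xi].
    They are invertible because [G] is non-degenerate, and [f'_j K' = f_j Z],
    [f'_ij K' = f_ij Z], so that [L = Z K'^-1] satisfies [f'_j = f_j L] and
    [f'_ij = f_ij L].  Differentiating the first relation gives [f_j d_i L = 0],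
    that is [d_i L = Xi eta_i] for row vectors [eta_i]; differentiating the
    second and commuting the third derivatives of [f] and [f'] gives
    [G_ij eta_k = G_kj eta_i], and contraction with the inverse of [G] leaves
    [(n - 1) eta_k = 0].  So [L] is locally constant, whence [f' = f L + b] and
    [L Xi' = phi Xi] near each point ([local_rigidity]).  Since the first and
    second derivatives of [f] span the ambient space, [(L, b)] is determined
    near every point, and the local solutions agree because [M] is connected
    ([connected_gluing]). *)

(** * Mean values and constancy *)

Section Calculus.
Context {R : realType} {n : nat}.
Implicit Types (x y v : 'rV[R]_n) (V : set 'rV[R]_n).

Lemma mean_value_line (h : 'rV[R]_n -> R) x v :
  (forall t : R, 0 <= t <= 1 -> differentiable h (x + t *: v)) ->
  exists2 t : R, 0 <= t <= 1 & h (x + v) - h x = 'D_v h (x + t *: v).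
Proof.
move=> dh; pose g (t : R) : R := h (x + t *: v).
have line (t : R) : is_derive t (1 : R) (fun s : R => x + s *: v) v.
  have dl : differentiable (fun s : R => s *: v) t.
    by apply: differentiableZl.
  split.
    apply: derivableD; first exact: derivable_cst.
    exact: diff_derivable.
  rewrite deriveD; [|exact: derivable_cst|exact: diff_derivable].
  by rewrite derive_cst add0r deriveE// diffZl// diff_val scale1r.
have dg (t : R) : 0 <= t <= 1 -> is_derive t 1 g ('D_v h (x + t *: v)).
  move=> /dh dht; have [dl lE] := line t.
  have dl' : differentiable (fun s : R => x + s *: v) t.
    exact/derivable1_diffP.
  have dgt : differentiable (h \o (fun s : R => x + s *: v)) t.
    exact: differentiable_comp.
  split; first exact: diff_derivable.
  by rewrite deriveE// diff_comp//= -!deriveE// lE.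
have cg : {within `[0, 1], continuous g}.
  apply: derivable_within_continuous => t; rewrite in_itv/= => /dg [] //.
have dg01 (t : R) : t \in `]0, 1[%R -> is_derive t 1 g ('D_v h (x + t *: v)).
  by rewrite in_itv/= => /andP[/ltW t0 /ltW t1]; apply: dg; rewrite t0 t1.
have [t] := MVT (ltr01 : 0 < 1 :> R) dg01 cg.
rewrite in_itv/= => /andP[t0 t1] E; exists t; first by rewrite (ltW t0) (ltW t1).
by move: E; rewrite subr0 mulr1 /g scale1r scale0r addr0.
Qed.

Lemma derive_pder (W : normedModType R) (h : 'rV[R]_n -> W) x v :
  differentiable h x -> 'D_v h x = \sum_i v 0 i *: pder i h x.
Proof.
move=> dh; rewrite deriveE// {1}(row_sum_delta v) linear_sum.
by apply: eq_bigr => i _; rewrite linearZ /pder -deriveE.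
Qed.

Lemma derive_scale (W : normedModType R) (h : 'rV[R]_n -> W) x i (s : R) :
  differentiable h x -> 'D_(s *: delta_mx 0 i) h x = s *: pder i h x.
Proof. by move=> dh; rewrite /pder !deriveE// linearZ. Qed.

Lemma ball_segment x y (r t : R) :
  ball x r y -> 0 <= t <= 1 -> ball x r (x + t *: (y - x)).
Proof.
rewrite -!ball_normE /ball_/= => xy /andP[t0 t1].
rewrite opprD addrA subrr sub0r normrN normrZ (ger0_norm t0) distrC.
by rewrite (le_lt_trans _ xy)// ler_piMl.
Qed.

Lemma pder0_constant_ball (h : 'rV[R]_n -> R) x (r : R) :
  (forall y, ball x r y -> differentiable h y) ->
  (forall y i, ball x r y -> pder i h y = 0) ->
  forall y, ball x r y -> h y = h x.
Proof.
move=> dh h0 y xy.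
have [t /(ball_segment xy)|t /(ball_segment xy) bt] := @mean_value_line h x (y - x).
  exact: dh.
rewrite (addrC x) subrK derive_pder; last exact: dh.
rewrite big1 => [/eqP|i _]; first by rewrite subr_eq0 => /eqP.
by rewrite h0// scaler0.
Qed.

End Calculus.

(** * Symmetry of mixed partial derivatives *)

Lemma differentiable_near (R : realType) (V W : normedModType R)
    (h k : V -> W) (x : V) :
  (\forall y \near x, h y = k y) -> differentiable h x -> differentiable k x.
Proof.
move=> hk dh.
have z0 : (k - h) \o shift x = cst ((k - h) x) + \0 +o_ 0 id.
  apply/eqaddoP => e e0.
  rewrite [\forall y \near _, _ <= _](near_shift x) sub0r.
  near=> y; rewrite /= !fctE /= addrNK.
  have -> : h y = k y by near: y.
  by rewrite (nbhs_singleton hk) !subrr addr0 subrr normr0 mulr_ge0// ltW.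
have -> : k = (fun y => h y + (k y - h y)).
  by apply/funext => y; rewrite addrC subrK.
apply: (@differentiableD _ _ _ h (k - h)) => //; apply/diff_locallyP.
have [c0 _] := dcst (0 : W) x.
by rewrite (@diff_unique _ _ _ (k - h) \0 x c0 z0).
Unshelve. all: by end_near. Qed.

Section Smooth.
Context {R : realType} {n : nat}.
Implicit Types (x y : 'rV[R]_n) (V : set 'rV[R]_n).

Lemma smooth_differentiable (W : normedModType R) V (h : 'rV[R]_n -> W) x :
  smooth_on V h -> V x -> differentiable h x.
Proof. by move=> sh; exact: (sh [::]). Qed.

(** Iterated partial derivatives are taken in the order of a list, so an extra
    innermost derivative is one more entry at its end. *)
Lemma smooth_pder (W : normedModType R) V (h : 'rV[R]_n -> W) i :
  smooth_on V h -> smooth_on V (pder i h).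
Proof. by move=> sh s x Vx; have := sh (rcons s i) x Vx; rewrite foldr_rcons. Qed.

Lemma pder_near (W : normedModType R) (h k : 'rV[R]_n -> W) x i :
  (\forall y \near x, h y = k y) -> pder i h x = pder i k x.
Proof. exact: near_eq_derive. Qed.

Lemma pder_open (W : normedModType R) V (h k : 'rV[R]_n -> W) x i :
  open V -> V x -> (forall y, V y -> h y = k y) -> pder i h x = pder i k x.
Proof.
move=> Vo Vx hk; apply: pder_near.
by apply: filterS (open_nbhs_nbhs (conj Vo Vx)).
Qed.

Lemma differentiable_open (W : normedModType R) V (h k : 'rV[R]_n -> W) x :
  open V -> V x -> (forall y, V y -> h y = k y) ->
  differentiable h x -> differentiable k x.
Proof.
move=> Vo Vx hk; apply: differentiable_near.
by apply: filterS (open_nbhs_nbhs (conj Vo Vx)).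
Qed.

Lemma pder_coord p q (h : 'rV[R]_n -> 'M[R]_(p, q)) x i a b :
  differentiable h x -> pder i h x a b = pder i (fun y => h y a b) x.
Proof. by move=> dh; rewrite /pder derive_mx ?mxE//; apply: diff_derivable. Qed.

(** An identity on an open set persists under differentiation, which carries the
    passage to an entry through all the iterated derivatives. *)
Lemma iter_pder_coord p q V (h : 'rV[R]_n -> 'M[R]_(p, q)) a b s :
  open V -> smooth_on V h -> forall x, V x ->
  foldr (fun i k => pder i k) h s x a b =
  foldr (fun i k => pder i k) (fun y => h y a b) s x.
Proof.
move=> Vo sh; elim: s => [//|i s IH] x Vx /=.
rewrite pder_coord; last exact: sh.
exact: (pder_open _ Vo).
Qed.

Lemma differentiable_coord_fun p q (h : 'rV[R]_n -> 'M[R]_(p, q)) x a b :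
  differentiable h x -> differentiable (fun y => h y a b) x.
Proof.
move=> dh; apply: (differentiable_comp (g := fun N : 'M[R]_(p, q) => N a b)) => //.
exact: differentiable_coord.
Qed.

Lemma norm_delta_row_le1 (i : 'I_n) : `|delta_mx 0 i : 'rV[R]_n| <= 1.
Proof.
rewrite /Num.Def.normr/= mx_normrE; apply: bigmax_le => // -[a b] _ /=.
by rewrite mxE; case: (_ && _); rewrite ?normr1 ?normr0.
Qed.

Lemma ball_two_steps x i j (a b s r : R) :
  `|a| <= s -> `|b| <= s -> s + s < r ->
  ball x r (x + a *: delta_mx 0 i + b *: delta_mx 0 j).
Proof.
move=> ha hb sr; rewrite -ball_normE /ball_/= -addrA opprD addrA subrr sub0r.
rewrite normrN (le_lt_trans (ler_normD _ _))//.
rewrite (le_lt_trans _ sr)// lerD// normrZ.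
  by rewrite (le_trans _ ha)// ler_piMr// norm_delta_row_le1.
by rewrite (le_trans _ hb)// ler_piMr// norm_delta_row_le1.
Qed.

Lemma differentiable_shift (h : 'rV[R]_n -> R) w y :
  differentiable h (y + w) -> differentiable (fun z => h (z + w)) y.
Proof.
move=> dh; apply: (differentiable_comp (f := fun z => z + w)) => //.
Qed.

Lemma pder_shift (h : 'rV[R]_n -> R) w y i :
  pder i (fun z => h (z + w)) y = pder i h (y + w).
Proof.
pose q (t : R) : R := t^-1 *: (h (t *: delta_mx 0 i + (y + w)) - h (y + w)).
have -> : pder i h (y + w) = lim (q @ 0^') by [].
rewrite /pder /derive; suff <- : (fun t : R => t^-1 *:
  (((fun z => h (z + w)) \o shift y) (t *: delta_mx 0 i) - h (y + w))) = q by [].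
by apply/funext => t; rewrite /q /= addrA.
Qed.

(** Two mean value steps, one in each direction, turn the second difference of
    [h] into a value of a mixed derivative; exchanging the directions leaves the
    second difference unchanged. *)
Lemma second_difference V (h : 'rV[R]_n -> R) x i j (s r : R) :
  smooth_on V h -> (forall y, ball x r y -> V y) -> 0 < s -> s + s < r ->
  exists2 y, ball x r y &
    h (x + s *: delta_mx 0 i + s *: delta_mx 0 j) - h (x + s *: delta_mx 0 i)
     - (h (x + s *: delta_mx 0 j) - h x) = s * (s * pder j (pder i h) y).
Proof.
move=> sh rV s0 sr.
have small (t : R) : 0 <= t <= 1 -> `|t * s| <= s.
  by move=> /andP[t0 t1]; rewrite ger0_norm ?ler_piMl ?mulr_ge0// ltW.
have ss : `|s| <= s by rewrite ger0_norm// ltW.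
have s00 : `|0 : R| <= s by rewrite normr0 ltW.
have Vij (a b : R) : `|a| <= s -> `|b| <= s ->
    V (x + a *: delta_mx 0 i + b *: delta_mx 0 j).
  by move=> ha hb; apply: rV; apply: ball_two_steps sr.
pose g y := h (y + s *: delta_mx 0 j) - h y.
have dV y : V y -> differentiable h y by exact: smooth_differentiable.
have dsh a : `|a| <= s ->
    differentiable (fun z => h (z + s *: delta_mx 0 j)) (x + a *: delta_mx 0 i).
  by move=> ha; apply/differentiable_shift/dV/Vij.
have dh0 a : `|a| <= s -> differentiable h (x + a *: delta_mx 0 i).
  by move=> ha; have := dV _ (Vij _ _ ha s00); rewrite scale0r addr0.
have dg a : `|a| <= s -> differentiable g (x + a *: delta_mx 0 i).
  by move=> ha; apply: differentiableB; [exact: dsh|exact: dh0].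
have [t t01|t t01 gE] := @mean_value_line _ _ g x (s *: delta_mx 0 i).
  by rewrite scalerA; apply/dg/small.
have [t' t'01|t' t'01 hE] := @mean_value_line _ _ (pder i h)
    (x + (t * s) *: delta_mx 0 i) (s *: delta_mx 0 j).
  rewrite scalerA; apply: (smooth_differentiable (smooth_pder i sh)).
  by apply: Vij; exact: small.
exists (x + (t * s) *: delta_mx 0 i + (t' * s) *: delta_mx 0 j).
  by apply: ball_two_steps sr; exact: small.
rewrite -[LHS]/(g (x + s *: delta_mx 0 i) - g x) {}gE scalerA.
rewrite derive_scale; last exact/dg/small.
rewrite {1}/pder deriveB; last 2 first.
- exact/diff_derivable/dsh/small.
- exact/diff_derivable/dh0/small.
rewrite -/(pder i h _) -/(pder i _ _) pder_shift hE scalerA derive_scale//.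
apply: (smooth_differentiable (smooth_pder i sh)).
by apply: Vij; exact: small.
Qed.

Lemma dist_le_halves (a b c d e : R) :
  c = d -> `|a - c| < e / 2 -> `|b - d| < e / 2 -> `|a - b| <= e.
Proof.
move=> -> ad bd; rewrite (le_trans (ler_distD d _ _))//.
by rewrite (splitr e) lerD// ltW// distrC.
Qed.

(** Both mixed derivatives at [x] are limits of the same second difference
    quotient. *)
Lemma pder_comm_scalar V (h : 'rV[R]_n -> R) x i j :
  open V -> smooth_on V h -> V x -> pder i (pder j h) x = pder j (pder i h) x.
Proof.
move=> Vo sh Vx.
have cont k l : {for x, continuous (pder k (pder l h))}.
  apply: differentiable_continuous.
  exact: (smooth_differentiable (smooth_pder k (smooth_pder l sh))).
apply/eqP; rewrite -subr_eq0 -normr_le0; apply/ler_addgt0Pr => e e0.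
rewrite add0r.
have e20 : 0 < e / 2 by rewrite divr_gt0.
have nV : nbhs x V by exact: open_nbhs_nbhs.
have near_e k l :
    \forall y \near x, `|pder k (pder l h) x - pder k (pder l h) y| < e / 2.
  by have /cvgrPdist_lt/(_ _ e20) := cont k l.
have /nbhs_ballP[r /= r0 rP] : \forall y \near x,
    [/\ V y, `|pder i (pder j h) x - pder i (pder j h) y| < e / 2
      & `|pder j (pder i h) x - pder j (pder i h) y| < e / 2].
  apply: filterS (filterI nV (filterI (near_e i j) (near_e j i))).
  by move=> y [Vy [yij yji]].
(* Both steps together must stay inside the ball of radius [r]. *)
pose s := r / 4.
have s0 : 0 < s by rewrite divr_gt0.
have sr : s + s < r by rewrite /s; lra.
have rV y : ball x r y -> V y by move=> /rP[].
have [y /rP[_ _ yE] Ey] := @second_difference V h x i j s r sh rV s0 sr.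
have [z /rP[_ zE _] Ez] := @second_difference V h x j i s r sh rV s0 sr.
have zy : pder i (pder j h) z = pder j (pder i h) y.
  apply: (mulfI (lt0r_neq0 s0)); apply: (mulfI (lt0r_neq0 s0)).
  have swap (a b c d : R) : a - b - (c - d) = a - c - (b - d) by ring.
  apply: etrans (esym Ez) _; apply: etrans _ Ey.
  by rewrite (addrAC x (s *: delta_mx 0 j)); exact: swap.
exact: (dist_le_halves zy zE yE).
Qed.

Lemma pder_comm p q V (h : 'rV[R]_n -> 'M[R]_(p, q)) x i j :
  open V -> smooth_on V h -> V x -> pder i (pder j h) x = pder j (pder i h) x.
Proof.
move=> Vo sh Vx; apply/matrixP => a b.
apply: etrans (iter_pder_coord a b [:: i; j] Vo sh Vx) _.
apply: etrans _ (esym (iter_pder_coord a b [:: j; i] Vo sh Vx)).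
apply: (pder_comm_scalar _ _ Vo _ Vx) => s y Vy.
apply: (differentiable_open Vo Vy (iter_pder_coord a b s Vo sh)).
exact/differentiable_coord_fun/sh.
Qed.

End Smooth.

(** * Calculus of matrix-valued functions *)

Section MatrixCalculus.
Context {R : realType} {n : nat}.
Implicit Types (x y : 'rV[R]_n) (V : set 'rV[R]_n).

(** Differentiability entry by entry: products, determinants and inverses of
    matrices are built from scalar operations on entries. *)
Definition entries_differentiable p q (A : 'rV[R]_n -> 'M[R]_(p, q)) x :=
  forall a b, differentiable (fun y => A y a b) x.

Lemma entries_derivable p q (A : 'rV[R]_n -> 'M[R]_(p, q)) x v :
  entries_differentiable A x -> derivable A x v.
Proof. by move=> dA; apply/derivable_mxP => a b; exact: diff_derivable. Qed.

Lemma differentiable_entries p q (A : 'rV[R]_n -> 'M[R]_(p, q)) x :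
  differentiable A x -> entries_differentiable A x.
Proof. by move=> dA a b; exact: differentiable_coord_fun. Qed.

Lemma pder_entry p q (A : 'rV[R]_n -> 'M[R]_(p, q)) x i a b :
  entries_differentiable A x -> pder i A x a b = pder i (fun y => A y a b) x.
Proof. by move=> dA; rewrite /pder derive_mx ?mxE//; exact: entries_derivable. Qed.

Lemma differentiable_fun_sum (I : Type) (r : seq I) (F : I -> 'rV[R]_n -> R) x :
  (forall i, differentiable (F i) x) ->
  differentiable (fun y => \sum_(i <- r) F i y) x.
Proof.
move=> dF; elim: r => [|i r IH].
  by under [X in differentiable X _]eq_fun do rewrite big_nil.
under [X in differentiable X _]eq_fun do rewrite big_cons.
by apply: differentiableD.
Qed.

Lemma differentiable_fun_prod (I : Type) (r : seq I) (F : I -> 'rV[R]_n -> R) x :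
  (forall i, differentiable (F i) x) ->
  differentiable (fun y => \prod_(i <- r) F i y) x.
Proof.
move=> dF; elim: r => [|i r IH].
  by under [X in differentiable X _]eq_fun do rewrite big_nil.
under [X in differentiable X _]eq_fun do rewrite big_cons.
by apply: differentiableM.
Qed.

Lemma entries_mulmx p q r (A : 'rV[R]_n -> 'M[R]_(p, q))
    (B : 'rV[R]_n -> 'M[R]_(q, r)) x :
  entries_differentiable A x -> entries_differentiable B x ->
  entries_differentiable (fun y => A y *m B y) x.
Proof.
move=> dA dB a b; under [X in differentiable X _]eq_fun do rewrite mxE.
by apply: differentiable_fun_sum => k; exact: differentiableM.
Qed.

Lemma pder_mulmx p q r (A : 'rV[R]_n -> 'M[R]_(p, q))
    (B : 'rV[R]_n -> 'M[R]_(q, r)) x i :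
  entries_differentiable A x -> entries_differentiable B x ->
  pder i (fun y => A y *m B y) x = pder i A x *m B x + A x *m pder i B x.
Proof.
move=> dA dB; apply/matrixP => a b.
rewrite pder_entry; last exact: entries_mulmx.
rewrite !mxE -big_split/=.
have -> : (fun y => (A y *m B y) a b) = \sum_k (fun y => A y a k * B y k b).
  by apply/funext => y; rewrite mxE fct_sumE.
rewrite /pder derive_sum => [|k]; last exact/diff_derivable/differentiableM.
apply: eq_bigr => k _; rewrite deriveM; try exact: diff_derivable.
rewrite -/(pder i _ x) -/(pder i (fun y => A y a k) x) -!pder_entry//.
by rewrite addrC; congr (_ + _); exact: mulrC.
Qed.

Lemma differentiable_det p (A : 'rV[R]_n -> 'M[R]_p) x :
  entries_differentiable A x -> differentiable (fun y => \det (A y)) x.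
Proof.
move=> dA; apply: differentiable_fun_sum => s; apply: differentiableM => //.
exact: differentiable_fun_prod.
Qed.

(** By the cofactor formula, the entries of the inverse are rational functions
    of the entries. *)
Lemma entries_invmx p (A : 'rV[R]_n -> 'M[R]_p) V x :
  open V -> V x -> (forall y, V y -> A y \in unitmx) ->
  entries_differentiable A x -> entries_differentiable (fun y => invmx (A y)) x.
Proof.
move=> Vo Vx uA dA a b.
apply: (@differentiable_open _ _ _ _
  (fun y => (\det (A y))^-1 * ((-1) ^+ (b + a) * \det (row' b (col' a (A y)))))
  _ _ Vo Vx).
  by move=> y /uA uAy; rewrite /invmx uAy !mxE.
apply: differentiableM.
  by apply: differentiableV; [exact: differentiable_det|rewrite -unitfE; exact: uA].
apply: differentiableM => //; apply: differentiable_det => c d.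
by under [X in differentiable X _]eq_fun do rewrite !mxE.
Qed.

Lemma row_jacobian p (h : 'rV[R]_n -> 'rV[R]_p) x i :
  differentiable h x -> row i ('J h x) = pder i h x.
Proof. by move=> dh; rewrite /pder deriveEjacobian// rowE. Qed.

Lemma pder0_constant_ball_mx p q (A : 'rV[R]_n -> 'M[R]_(p, q)) x (r : R) :
  (forall y, ball x r y -> entries_differentiable A y) ->
  (forall y i, ball x r y -> pder i A y = 0) ->
  forall y, ball x r y -> A y = A x.
Proof.
move=> dA A0 y xy; apply/matrixP => a b.
apply: (@pder0_constant_ball _ _ (fun z => A z a b) x r) => // z.
  by move=> /dA.
by move=> i xz; rewrite -pder_entry ?A0 ?mxE//; exact: dA.
Qed.

End MatrixCalculus.

(** * Gluing on connected spaces and manifolds *)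

Section Topology.

(** The set where a given value works is open by hypothesis; its complement is
    the union of the sets where another value works, hence open as well. *)
Lemma connected_gluing (M : topologicalType) (T : Type) (P : T -> M -> Prop)
    (p0 : M) :
  connected [set: M] -> (forall a, open [set p | P a p]) ->
  (forall p, exists a, P a p) ->
  (forall p a b, P a p -> P b p -> a = b) ->
  exists a, forall p, P a p.
Proof.
move=> Mc Po Pex Puniq; have [a Pa] := Pex p0; exists a.
suff PT : [set p | P a p] = [set: M].
  by move=> p; have : [set: M] p by []; rewrite -PT.
apply: Mc.
- by exists p0.
- by exists [set p | P a p]; rewrite ?setTI.
- exists [set p | P a p]; rewrite ?setTI// -openC.
  have -> : ~` [set p | P a p] = \bigcup_(b in [set b | b <> a]) [set p | P b p].
    apply/seteqP; split => [p nPa|p [b ba Pb] Pa'].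
      have [b Pb] := Pex p; exists b => // ba.
      by apply: nPa; rewrite -ba.
    exact: (ba (Puniq _ _ _ Pb Pa')).
  exact: bigcup_open.
Qed.

End Topology.

Section Charts.
Context {R : realType} {n : nat}.
Variable M : topologicalType.
Implicit Types (c : chart R n M) (p : M).

Lemma coord_near c p (A : set 'rV[R]_n) :
  is_chart c -> dom c p -> nbhs (coord c p) A ->
  \forall q \near p, dom c q /\ A (coord c q).
Proof.
move=> cc cp nA.
have np : nbhs p (dom c) by apply: open_nbhs_nbhs; split=> //; exact: chart_dom_open.
apply: filterI => //.
have := chart_coord_cont cc.
rewrite continuous_open_subspace//; last exact: chart_dom_open.
by move=> /(_ p); rewrite inE => /(_ cp); apply.
Qed.

Lemma param_near c p (A : set M) :
  is_chart c -> dom c p -> nbhs p A ->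
  \forall x \near coord c p, A (param c x).
Proof.
move=> cc cp nA.
have := chart_param_cont cc.
rewrite continuous_open_subspace//; last exact: chart_range_open.
move=> /(_ (coord c p)); rewrite inE => /(_ (ex_intro2 _ _ p cp erefl)); apply.
by rewrite chart_coordK.
Qed.

End Charts.

(** * Rigidity of an immersion with a co-normal field *)

Lemma unitmx_kernel (F : fieldType) p (A : 'M[F]_p) :
  (forall q (w : 'M[F]_(p, q)), A *m w = 0 -> w = 0) -> A \in unitmx.
Proof.
move=> A0; rewrite -row_full_unit /row_full eqn_leq rank_leq_col -subn_eq0.
by rewrite -mxrank_coker (A0 _ (cokermx A)) ?mulmx_coker ?mxrank0.
Qed.

Section DualPairs.
Context {R : realType} {n : nat}.
Implicit Types (x y : 'rV[R]_n) (V : set 'rV[R]_n).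
Implicit Types (f : 'rV[R]_n -> 'rV[R]_(n + 1)) (Xi : 'rV[R]_n -> 'cV[R]_(n + 1)).

Definition second_form f Xi x : 'M[R]_n :=
  \matrix_(i, j) (pder i (pder j f) x *m Xi x) 0 0.

(** The part of a relative co-normalisation that mentions no transversal field,
    expressed on an open set of coordinates. *)
Record nondegenerate_pair V f Xi : Prop := NondegeneratePair {
  np_immersion_smooth : smooth_on V f;
  np_conormal_smooth : smooth_on V Xi;
  np_tangent : forall x, V x -> 'J f x *m Xi x = 0;
  np_unit : forall x, V x -> second_form f Xi x \in unitmx }.

Definition dual_frame Xi x : 'M[R]_(n + 1) :=
  row_mx (\matrix_(a, k) pder k Xi x a 0) (Xi x).

Section OnePair.
Variables (V : set 'rV[R]_n) (f : 'rV[R]_n -> 'rV[R]_(n + 1)).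
Variable Xi : 'rV[R]_n -> 'cV[R]_(n + 1).
Hypothesis (Vo : open V) (fXi : nondegenerate_pair V f Xi).

Let sf := np_immersion_smooth fXi.
Let sXi := np_conormal_smooth fXi.

Lemma pair_differentiable x : V x -> differentiable f x.
Proof. exact: smooth_differentiable. Qed.

Lemma row_jacobian_mul p x j (w : 'M[R]_(n + 1, p)) :
  V x -> row j ('J f x *m w) = pder j f x *m w.
Proof. by move=> Vx; rewrite row_mul row_jacobian//; exact: pair_differentiable. Qed.

Lemma pair_tangent x j : V x -> pder j f x *m Xi x = 0.
Proof. by move=> Vx; rewrite -row_jacobian_mul// (np_tangent fXi)// row0. Qed.

Lemma second_form_sym x : V x -> (second_form f Xi x)^T = second_form f Xi x.
Proof.
move=> Vx; apply/matrixP => i j; rewrite !mxE.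
by rewrite (pder_comm j i Vo sf Vx).
Qed.

Lemma pair_scalar x i j :
  pder i (pder j f) x *m Xi x = (second_form f Xi x i j)%:M.
Proof. by rewrite [LHS]mx11_scalar; congr (_%:M); rewrite [RHS]mxE. Qed.

Lemma entries_pder_immersion x j :
  V x -> entries_differentiable (pder j f) x.
Proof.
move=> Vx; apply: differentiable_entries.
exact: smooth_differentiable (smooth_pder j sf) Vx.
Qed.

Lemma entries_conormal x : V x -> entries_differentiable Xi x.
Proof.
by move=> Vx; apply: differentiable_entries; exact: smooth_differentiable sXi Vx.
Qed.

(** Differentiating [f_j Xi = 0]: the derivatives of the co-normal see the
    second fundamental form. *)
Lemma pair_tangent_pder x j k : V x ->
  pder j f x *m pder k Xi x = - (second_form f Xi x j k)%:M.
Proof.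
move=> Vx.
have : pder k (fun y => pder j f y *m Xi y) x = 0.
  rewrite (pder_open (k := cst 0) k Vo Vx) => [|y Vy]; last exact: pair_tangent.
  by rewrite /pder derive_cst.
rewrite pder_mulmx; [|exact: entries_pder_immersion|exact: entries_conormal].
move/eqP; rewrite addrC addr_eq0 => /eqP ->.
by rewrite pair_scalar -{1}(second_form_sym Vx) mxE.
Qed.

Lemma jacobian_dual_frame x : V x ->
  'J f x *m dual_frame Xi x = row_mx (- second_form f Xi x) 0.
Proof.
move=> Vx; rewrite mul_mx_row (np_tangent fXi)//; congr row_mx.
apply/matrixP => j k.
transitivity ((pder j f x *m pder k Xi x) 0 0).
  rewrite -row_jacobian ?mxE; last exact: pair_differentiable.
  by apply: eq_bigr => a _; rewrite !mxE.
by rewrite pair_tangent_pder// !mxE.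
Qed.

Lemma second_form_kernel p x (w : 'M[R]_(1, p)) : (0 < n)%N -> V x ->
  (forall i j, second_form f Xi x i j *: w = 0) -> w = 0.
Proof.
move=> n0 Vx w0; apply/eqP; apply/negPn/negP => wn0.
have G0 : second_form f Xi x = 0.
  apply/matrixP => i j; have /eqP := w0 i j.
  by rewrite scaler_eq0 (negPf wn0) orbF mxE => /eqP; rewrite !mxE.
have := mulmxV (np_unit fXi Vx); rewrite G0 mul0mx.
move=> /matrixP/(_ (Ordinal n0) (Ordinal n0)) /eqP.
by rewrite !mxE eqxx eq_sym oner_eq0.
Qed.

(** Pairing with the tangent vectors detects the coefficients along the
    derivatives of the co-normal, because the second fundamental form is
    non-degenerate; pairing with the second derivatives of the immersion then
    detects the coefficient of the co-normal. *)
Lemma dual_frame_unit x : (0 < n)%N -> V x -> dual_frame Xi x \in unitmx.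
Proof.
move=> n0 Vx; apply: unitmx_kernel => q w Kw.
have w1 : usubmx w = 0.
  have : 'J f x *m (dual_frame Xi x *m w) = 0 by rewrite Kw mulmx0.
  rewrite mulmxA jacobian_dual_frame// -{1}(vsubmxK w) mul_row_col mul0mx addr0.
  rewrite mulNmx => /eqP; rewrite oppr_eq0 => /eqP Gw.
  by rewrite -(mulKmx (np_unit fXi Vx) (usubmx w)) Gw mulmx0.
have w2 : dsubmx w = 0.
  apply: (second_form_kernel n0 Vx) => i j.
  rewrite -mul_scalar_mx -pair_scalar -mulmxA.
  suff -> : Xi x *m dsubmx w = 0 by rewrite mulmx0.
  by move: Kw; rewrite -{1}(vsubmxK w) mul_row_col w1 mulmx0 add0r.
by rewrite -(vsubmxK w) w1 w2 col_mx0.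
Qed.

(** The columns of the dual frame form a basis in which the coefficients along
    the derivatives of the co-normal are determined by pairing with the tangent
    vectors; only the co-normal component survives. *)
Lemma tangent_annihilator p x (w : 'M[R]_(n + 1, p)) : (0 < n)%N -> V x ->
  'J f x *m w = 0 -> exists eta : 'M[R]_(1, p), w = Xi x *m eta.
Proof.
move=> n0 Vx Jw; pose z := invmx (dual_frame Xi x) *m w.
have wE : w = dual_frame Xi x *m z by rewrite mulKVmx//; exact: dual_frame_unit.
exists (dsubmx z); move: Jw; rewrite wE mulmxA jacobian_dual_frame//.
rewrite -{1 2}(vsubmxK z) !mul_row_col mul0mx addr0.
rewrite mulNmx => /eqP; rewrite oppr_eq0 => /eqP Gz.
by rewrite -(mulKmx (np_unit fXi Vx) (usubmx z)) Gz !mulmx0 add0r.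
Qed.

(** In dual form: the first and second derivatives of the immersion span the
    ambient space, since the latter reach the co-normal direction through the
    non-degenerate second fundamental form. *)
Lemma osculating_kernel p x (w : 'M[R]_(n + 1, p)) : (0 < n)%N -> V x ->
  'J f x *m w = 0 -> (forall i j, pder i (pder j f) x *m w = 0) -> w = 0.
Proof.
move=> n0 Vx Jw fw; have [eta wE] := tangent_annihilator n0 Vx Jw.
suff eta0 : eta = 0 by rewrite wE eta0 mulmx0.
apply: (second_form_kernel n0 Vx) => i j.
by rewrite -mul_scalar_mx -pair_scalar -mulmxA -wE.
Qed.

End OnePair.

Section Rigidity.
Variables (V : set 'rV[R]_n) (f f' : 'rV[R]_n -> 'rV[R]_(n + 1)).
Variables (Xi Xi' : 'rV[R]_n -> 'cV[R]_(n + 1)).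
Variable Z : 'rV[R]_n -> 'M[R]_(n + 1).
Hypothesis (Vo : open V) (n1 : (1 < n)%N).
Hypothesis (fXi : nondegenerate_pair V f Xi).
Hypothesis (fXi' : nondegenerate_pair V f' Xi').
Hypothesis dZ : forall x, V x -> entries_differentiable Z x.
Hypothesis JZ : forall x, V x -> 'J f x *m Z x = 'J f' x *m dual_frame Xi' x.
Hypothesis HZ : forall x, V x -> forall i j,
  pder i (pder j f) x *m Z x = pder i (pder j f') x *m dual_frame Xi' x.

Let n0 : (0 < n)%N := ltnW n1.
Let L x : 'M[R]_(n + 1) := Z x *m invmx (dual_frame Xi' x).

Let frame_unit x : V x -> dual_frame Xi' x \in unitmx.
Proof. exact: (dual_frame_unit Vo fXi'). Qed.

Let L_frame x : V x -> L x *m dual_frame Xi' x = Z x.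
Proof. by move=> Vx; rewrite mulmxKV//; exact: frame_unit. Qed.

Let L_jacobian x : V x -> 'J f' x = 'J f x *m L x.
Proof. by move=> Vx; rewrite mulmxA JZ// mulmxK//; exact: frame_unit. Qed.

Let L_first x j : V x -> pder j f' x = pder j f x *m L x.
Proof.
move=> Vx; rewrite -(row_jacobian_mul fXi)// -L_jacobian//.
by rewrite row_jacobian//; exact: (pair_differentiable fXi').
Qed.

Let L_second x i j : V x -> pder i (pder j f') x = pder i (pder j f) x *m L x.
Proof. by move=> Vx; rewrite mulmxA HZ// mulmxK//; exact: frame_unit. Qed.

Let dL x : V x -> entries_differentiable L x.
Proof.
move=> Vx; apply: entries_mulmx; first exact: dZ.
apply: (entries_invmx Vo Vx) => // a b.
rewrite /dual_frame; under [X in differentiable X _]eq_fun do rewrite mxE.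
case: (fintype.split b) => k; last exact: (entries_conormal fXi').
under [X in differentiable X _]eq_fun do rewrite mxE.
apply: differentiable_entries.
exact: smooth_differentiable (smooth_pder k (np_conormal_smooth fXi')) Vx.
Qed.

Let entries_second x i j : V x -> entries_differentiable (pder i (pder j f)) x.
Proof.
move=> Vx; apply: differentiable_entries; apply: smooth_differentiable Vx.
exact/smooth_pder/smooth_pder/(np_immersion_smooth fXi).
Qed.

Let tangent_pder x i : V x -> 'J f x *m pder i L x = 0.
Proof.
move=> Vx; apply/row_matrixP => j; rewrite (row_jacobian_mul fXi)// row0.
have := pder_open (h := pder j f') (k := fun y => pder j f y *m L y) i Vo Vx.
move=> /(_ (fun y Vy => L_first j Vy)).
rewrite pder_mulmx; [|exact: (entries_pder_immersion fXi)|exact: dL].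
rewrite L_second// => /eqP; rewrite -subr_eq0 opprD addrA subrr sub0r oppr_eq0.
by move=> /eqP.
Qed.

(* Differentiating [f'_ij = f_ij L] leaves the terms below once the third
   derivatives of both immersions are commuted. *)
Let second_pder x i j k : V x ->
  pder i (pder j f) x *m pder k L x = pder k (pder j f) x *m pder i L x.
Proof.
move=> Vx.
have E a b : pder a (pder b (pder j f')) x =
    pder a (pder b (pder j f)) x *m L x + pder b (pder j f) x *m pder a L x.
  rewrite -pder_mulmx; [|exact: entries_second|exact: dL].
  by apply: (pder_open a Vo Vx) => y Vy; exact: L_second.
have C' := pder_comm k i Vo (smooth_pder j (np_immersion_smooth fXi')) Vx.
have C := pder_comm k i Vo (smooth_pder j (np_immersion_smooth fXi)) Vx.
apply: (addrI (pder k (pder i (pder j f)) x *m L x)).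
apply: etrans (esym (E k i)) _; apply: etrans C' _; apply: etrans (E i k) _.
exact: (congr1 (fun T => T *m L x + _) (esym C)).
Qed.

Let L_pder0 x k : V x -> pder k L x = 0.
Proof.
move=> Vx; pose G := second_form f Xi x.
have /boolp.choice[eta etaE] i : exists eta : 'M[R]_(1, n + 1),
    pder i L x = Xi x *m eta.
  exact: (tangent_annihilator Vo fXi n0 Vx (tangent_pder i Vx)).
have Geta i j l : G i j *: eta l = G l j *: eta i.
  have GE a b c : G a b *: eta c = pder a (pder b f) x *m pder c L x.
    apply: etrans _ (congr1 (mulmx (pder a (pder b f) x)) (esym (etaE c))).
    by rewrite mulmxA pair_scalar mul_scalar_mx.
  exact: etrans (GE i j l) (etrans (second_pder i j l Vx) (esym (GE l j i))).
suff eta0 : eta k = 0 by apply: etrans (etaE k) _; rewrite eta0 mulmx0.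
(* Contracting with the inverse of [G] yields [n eta_k = eta_k]. *)
have : \sum_i \sum_j invmx G j i *: (G i j *: eta k) =
       \sum_i \sum_j invmx G j i *: (G k j *: eta i).
  by apply: eq_bigr => i _; apply: eq_bigr => j _; rewrite Geta.
have uG : G \in unitmx by exact: np_unit fXi x Vx.
have -> : \sum_i \sum_j invmx G j i *: (G i j *: eta k) = n%:R *: eta k.
  transitivity (\sum_(i < n) eta k); last by rewrite sumr_const card_ord scaler_nat.
  apply: eq_bigr => i _; under eq_bigr do rewrite scalerA mulrC.
  rewrite -scaler_suml.
  have := congr1 (fun A : 'M[R]_n => A i i) (mulmxV uG).
  by rewrite !mxE eqxx => ->; rewrite scale1r.
have -> : \sum_i \sum_j invmx G j i *: (G k j *: eta i) = eta k.
  rewrite (bigD1 k)//= [X in _ + X]big1 ?addr0 => [|i ik].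
    under eq_bigr do rewrite scalerA mulrC.
    rewrite -scaler_suml.
    have := congr1 (fun A : 'M[R]_n => A k k) (mulmxV uG).
    by rewrite !mxE eqxx => ->; rewrite scale1r.
  under eq_bigr do rewrite scalerA mulrC.
  rewrite -scaler_suml.
  have := congr1 (fun A : 'M[R]_n => A k i) (mulmxV uG).
  by rewrite !mxE eq_sym (negPf ik) => ->; rewrite scale0r.
move/eqP; rewrite -subr_eq0 -{2}(scale1r (eta k)) -scalerBl scaler_eq0.
by rewrite subr_eq0 pnatr_eq1 gtn_eqF//= => /eqP.
Qed.

(** Two pairs whose first and second derivatives correspond under [Z] and the
    dual frame of the second pair differ by an affine map: the transition matrix
    [L] has [d_i L = Xi eta_i], and the symmetry of third derivatives makes
    [eta] vanish in dimension at least two. *)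
Lemma local_rigidity x : V x ->
  exists (A : 'M[R]_(n + 1)) (b : 'rV[R]_(n + 1)), A \in unitmx /\
    \forall y \near x, f' y = f y *m A + b /\ A *m Xi' y = rsubmx (Z y).
Proof.
move=> Vx; have nV := open_nbhs_nbhs (conj Vo Vx).
have [r /= r0 rV] := iffLR (@nbhs_ballP _ _ _ _) nV.
have Lx y : ball x r y -> L y = L x.
  by apply: pder0_constant_ball_mx => [z /rV|z i /rV]; [exact: dL|exact: L_pder0].
exists (L x), (f' x - f x *m L x); split.
  apply: unitmx_kernel => q w Lw; apply: (osculating_kernel Vo fXi' n0 Vx).
    by rewrite L_jacobian// -mulmxA Lw mulmx0.
  by move=> i j; rewrite L_second// -mulmxA Lw mulmx0.
have df y : V y -> entries_differentiable f y.
  by move=> Vy; apply: differentiable_entries; exact: (pair_differentiable fXi).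
have df' y : V y -> entries_differentiable f' y.
  by move=> Vy; apply: differentiable_entries; exact: (pair_differentiable fXi').
have cL y : entries_differentiable (cst (L x)) y.
  by move=> a b; exact: differentiable_cst.
pose h y := f' y - f y *m L x.
have hE y : ball x r y -> h y = h x.
  apply: pder0_constant_ball_mx => [z /rV Vz a b|z i xz].
    under [X in differentiable X _]eq_fun do rewrite !mxE.
    apply: differentiableB; first exact: df'.
    apply: differentiable_fun_sum => k; apply: differentiableM => //; exact: df.
  have Vz := rV _ xz.
  have cz : pder i (cst (L x)) z = 0 by rewrite /pder derive_cst.
  have fLz : pder i (fun y => f y *m L x) z = pder i f z *m L x.
    by apply: etrans (pder_mulmx i (df z Vz) (cL z)) _; rewrite cz mulmx0 addr0.
  have hz : pder i h z = pder i f' z - pder i (fun y => f y *m L x) z.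
    apply: deriveB; apply: entries_derivable; first exact: df'.
    exact: entries_mulmx (df z Vz) (cL z).
  by rewrite hz fLz -(Lx z)// (L_first i Vz) subrr.
apply/nbhs_ballP; exists r => //= y xy; split.
  by rewrite -[_ - _]/(h x) -(hE y)// addrC subrK.
have := L_frame (rV _ xy); rewrite Lx// => <-.
by rewrite mul_mx_row row_mxKr.
Qed.

End Rigidity.

End DualPairs.

(** * Metric and cubic form of a relative co-normalisation *)

Section Christoffel.
Context {R : realType} {n : nat}.
Implicit Types (g : 'rV[R]_n -> 'M[R]_n) (x : 'rV[R]_n).

Definition christoffel_first_kind g x (i j k : 'I_n) : R :=
  2^-1 * (pder i (fun y => g y j k) x + pder j (fun y => g y i k) x
          - pder k (fun y => g y i j) x).

Lemma invmx_contract (G : 'M[R]_n) (a : 'I_n -> R) k : G^T = G -> G \in unitmx ->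
  \sum_l (\sum_m invmx G l m * a m) * G l k = a k.
Proof.
move=> Gs uG.
pose v : 'cV[R]_n := \col_m a m.
have := mulKVmx uG v => /matrixP/(_ k 0); rewrite !mxE => <-.
apply: eq_bigr => l _; rewrite mulrC -{1}Gs mxE; congr (_ * _).
by rewrite mxE; apply: eq_bigr => m _; rewrite mxE.
Qed.

(** The Levi-Civita connection with its upper index lowered no longer involves
    the inverse metric, so it scales simply under a conformal change. *)
Lemma christoffel_lower g x i j k : (g x)^T = g x -> g x \in unitmx ->
  \sum_l christoffel g x i j l * g x l k = christoffel_first_kind g x i j k.
Proof.
move=> gs ug; pose a m := christoffel_first_kind g x i j m.
rewrite -[RHS]/(a k) -(invmx_contract a k gs ug).
apply: eq_bigr => l _; congr (_ * _); rewrite /christoffel mulr_sumr.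
by apply: eq_bigr => m _; rewrite mulrCA.
Qed.

Lemma pder_scalar_mul (a b : 'rV[R]_n -> R) x i :
  differentiable a x -> differentiable b x ->
  pder i (fun y => a y * b y) x = pder i a x * b x + a x * pder i b x.
Proof.
move=> da db; have := @deriveM _ _ a b x (delta_mx 0 i).
move=> /(_ (diff_derivable da) (diff_derivable db)) E.
by apply: etrans E _; rewrite addrC; congr (_ + _); exact: mulrC.
Qed.

Lemma christoffel_first_kind_scale V (phi : 'rV[R]_n -> R) g g' x i j k :
  open V -> V x -> differentiable phi x -> entries_differentiable g x ->
  (forall y, V y -> g' y = phi y *: g y) ->
  christoffel_first_kind g' x i j k = phi x * christoffel_first_kind g x i j k +
    2^-1 * (pder i phi x * g x j k + pder j phi x * g x i k
            - pder k phi x * g x i j).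
Proof.
move=> Vo Vx dphi dg gg'.
have E a b d : pder a (fun y => g' y b d) x =
    pder a phi x * g x b d + phi x * pder a (fun y => g y b d) x.
  apply: etrans (pder_scalar_mul a dphi (dg b d)).
  by apply: (pder_open a Vo Vx) => y Vy; rewrite gg'// mxE.
rewrite /christoffel_first_kind !E.
move: (pder i phi x) (pder j phi x) (pder k phi x) (pder i (fun y => g y j k) x).
move: (pder j (fun y => g y i k) x) (pder k (fun y => g y i j) x) => *; ring.
Qed.

End Christoffel.

Section RelativeConormalisation.
Context {R : realType} {n : nat}.
Variables (M : manifold R n) (H : conormalisation M) (c : chart R n M).
Hypothesis (rH : is_relative_conormalisation H) (ac : atlas c).

Let V := chart_range c.
Let f := immersion H \o param c.
Let Xi := conormal H \o param c.
Let xi := transversal H \o param c.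

Lemma chart_range_atlas_open : open V.
Proof. exact: chart_range_open (atlas_charts ac). Qed.

(** A linear relation between the rows of the frame, paired with the co-normal,
    loses its tangential part; the coefficient of the transversal field is then
    zero, and the Jacobian has full rank. *)
Lemma frame_unit x : V x -> frame H c x \in unitmx.
Proof.
move=> Vx; rewrite -row_free_unit -kermx_eq0; apply/eqP.
have := mulmx_ker (frame H c x); move: (kermx _) => w.
rewrite /frame -(hsubmxK w) mul_row_col => wF.
have w2 : rsubmx w = 0.
  have /(congr1 (mulmx^~ (Xi x))) := wF.
  rewrite mulmxDl -!mulmxA (rc_annihilates rH ac Vx) mulmx0 add0r mul0mx.
  by rewrite (rc_dual_normalised rH) mulmx1.
move: wF; rewrite w2 mul0mx addr0 => wJ.
have Jfree : row_free ('J f x) by rewrite /row_free (rc_immersion rH ac Vx).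
have -> : lsubmx w = 0 by apply: (row_free_inj Jfree); rewrite wJ mul0mx.
by rewrite row_mx0.
Qed.

Lemma gauss_formula x i j : V x ->
  pder i (pder j f) x = lsubmx (gauss H c x i j) *m 'J f x
                        + assoc_G H c x i j *: xi x.
Proof.
move=> Vx; rewrite mxE -mul_scalar_mx -mx11_scalar.
have <- : gauss H c x i j *m frame H c x = pder i (pder j f) x.
  by rewrite mulmxKV//; exact: frame_unit.
by rewrite -{1}(hsubmxK (gauss H c x i j)) mul_row_col.
Qed.

Lemma assoc_GE x : V x -> assoc_G H c x = second_form f Xi x.
Proof.
move=> Vx; apply/matrixP => i j; rewrite [RHS]mxE gauss_formula//.
rewrite mulmxDl -mulmxA (rc_annihilates rH ac Vx) mulmx0 add0r.
by rewrite -scalemxAl (rc_dual_normalised rH) scalemx1 [RHS]mxE eqxx mulr1n.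
Qed.

Lemma relative_pair : nondegenerate_pair V f Xi.
Proof.
split.
- exact: rc_immersion_smooth rH c ac.
- exact: rc_conormal_smooth rH c ac.
- by move=> x; exact: rc_annihilates rH c ac x.
- by move=> x Vx; rewrite -assoc_GE//; exact: rc_nondegenerate rH c ac x Vx.
Qed.

Lemma assoc_G_sym x : V x -> (assoc_G H c x)^T = assoc_G H c x.
Proof.
move=> Vx; rewrite assoc_GE//.
exact: (second_form_sym chart_range_atlas_open relative_pair).
Qed.

Lemma assoc_G_differentiable x : V x -> entries_differentiable (assoc_G H c) x.
Proof.
move=> Vx i j.
apply: (@differentiable_open _ _ _ _
  (fun y => (pder i (pder j f) y *m Xi y) 0 0) _ _ chart_range_atlas_open Vx).
  by move=> y Vy; rewrite assoc_GE// [RHS]mxE.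
apply: entries_mulmx; last first.
  exact: (entries_conormal relative_pair).
apply: differentiable_entries; apply: smooth_differentiable Vx.
exact/smooth_pder/smooth_pder/(np_immersion_smooth relative_pair).
Qed.

(** The coefficient of [f_ij] along the derivatives of the co-normal; being
    free of the transversal field, it makes the dependence of the cubic form on
    the co-normal explicit. *)
Definition conormal_third_form x (i j k : 'I_n) : R :=
  (pder i (pder j f) x *m pder k Xi x) 0 0.

(** Pairing the Gauss formula with [d_k Xi]: the transversal term drops out
    because the normalisation is relative, and [<d_k Xi, f_l> = - G_lk] lowers
    the index of the induced connection. *)
Lemma assoc_CE x i j k : V x ->
  assoc_C H c x i j k =
  - conormal_third_form x i j k - christoffel_first_kind (assoc_G H c) x i j k.
Proof.
move=> Vx; rewrite /assoc_C.
under eq_bigr do rewrite mulrBl.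
rewrite sumrB christoffel_lower; last 2 first.
- exact: assoc_G_sym.
- exact: rc_nondegenerate rH c ac x Vx.
congr (_ - _); rewrite /conormal_third_form gauss_formula// mulmxDl -scalemxAl.
rewrite (rc_dual_relative rH ac Vx) scaler0 addr0 -mulmxA mxE -sumrN.
apply: eq_bigr => l _; rewrite -mulrN; congr (_ * _).
have := pair_tangent_pder chart_range_atlas_open relative_pair l k Vx.
rewrite -(row_jacobian_mul relative_pair)// -assoc_GE// => /matrixP/(_ 0 0).
by rewrite [LHS]mxE [RHS]mxE => ->; rewrite opprK [RHS]mxE eqxx mulr1n.
Qed.

End RelativeConormalisation.

(** * Conformal change of the co-normal field *)

Section ConformalChange.
Context {R : realType} {n : nat}.

Definition sym_metric (a : 'I_n -> R) (G : 'M[R]_n) : tensor3 R n := fun i j k =>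
  a i * G j k + a j * G i k + a k * G i j.

(** This trace is what makes the factor [(n + 2)^-1] in the definition of [u]
    split a cubic form into its trace and its trace-free part. *)
Lemma trace_sym_metric (a : 'I_n -> R) (G : 'M[R]_n) k :
  G^T = G -> G \in unitmx ->
  \sum_i \sum_j invmx G i j * sym_metric a G i j k = (n%:R + 2) * a k.
Proof.
move=> Gs uG.
have GV i j : \sum_l invmx G i l * G l j = (i == j)%:R.
  by have /matrixP/(_ i j) := mulVmx uG; rewrite !mxE.
have Gsym i j : G i j = G j i by rewrite -{1}Gs mxE.
have VS i j : invmx G i j = invmx G j i.
  by rewrite -[in LHS]Gs -trmx_inv mxE.
have pick (b : 'I_n -> R) : \sum_i b i * (i == k)%:R = b k.
  rewrite (bigD1 k)//= eqxx mulr1 big1 ?addr0// => i /negPf ->.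
  by rewrite mulr0.
under eq_bigr do under eq_bigr do rewrite /sym_metric 2!mulrDr.
under eq_bigr do rewrite !big_split/=.
rewrite !big_split/= [X in X + _ + _](_ : _ = a k); last first.
  rewrite -[RHS](pick a); apply: eq_bigr => i _.
  by rewrite -GV mulr_sumr; apply: eq_bigr => j _; rewrite mulrCA.
rewrite [X in _ + X + _](_ : _ = a k); last first.
  rewrite exchange_big/= -[RHS](pick a); apply: eq_bigr => i _.
  by rewrite -GV mulr_sumr; apply: eq_bigr => j _; rewrite mulrCA VS.
rewrite [X in _ + X](_ : _ = n%:R * a k); first by ring.
transitivity (\sum_(i < n) a k); last by rewrite sumr_const card_ord mulr_natl.
apply: eq_bigr => i _.
have GVii : \sum_l invmx G i l * G l i = 1 by rewrite GV eqxx.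
rewrite -[RHS]mulr1 -GVii mulr_sumr; apply: eq_bigr => j _.
by rewrite mulrCA (Gsym j i).
Qed.

Lemma pder_scale_mx p q (phi : 'rV[R]_n -> R) (A : 'rV[R]_n -> 'M[R]_(p, q)) x i :
  differentiable phi x -> entries_differentiable A x ->
  pder i (fun y => phi y *: A y) x = pder i phi x *: A x + phi x *: pder i A x.
Proof.
move=> dphi dA.
have dpA : entries_differentiable (fun y => phi y *: A y) x.
  move=> a b; under [X in differentiable X _]eq_fun do rewrite mxE.
  exact: differentiableM.
apply/matrixP => a b; rewrite pder_entry// !mxE pder_entry//.
rewrite -pder_scalar_mul//; congr (pder i _ x).
by apply/funext => y; rewrite mxE.
Qed.

Lemma pder_ln (phi : 'rV[R]_n -> R) x :
  differentiable phi x -> 0 < phi x ->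
  differentiable (fun y => ln (phi y)) x /\
  forall i, pder i (fun y => ln (phi y)) x = pder i phi x / phi x.
Proof.
move=> dphi phi0; have [dln lnE] := is_derive1_ln phi0.
have dln' : differentiable (@ln R) (phi x) by exact/derivable1_diffP.
have dc : differentiable (@ln R \o phi) x by exact: differentiable_comp.
split=> // i; rewrite /pder deriveE// diff_comp//= deriv1E// derive1E lnE.
by rewrite -deriveE.
Qed.

Variables (M : manifold R n) (H H' : conormalisation M) (c : chart R n M).
Hypotheses (rH : is_relative_conormalisation H)
  (rH' : is_relative_conormalisation H') (ac : atlas c).
Variable phi : 'rV[R]_n -> R.

Let V := chart_range c.
Let Vo : open V := chart_range_atlas_open ac.
Hypothesis dphi : forall x, V x -> differentiable phi x.

(** A conformal change of the metric enters the cubic form through the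
    Christoffel symbols only. *)
Lemma cubic_third_form_scale x i j k :
  (forall y, V y -> assoc_G H' c y = phi y *: assoc_G H c y) -> V x ->
  assoc_C H' c x i j k + conormal_third_form H' c x i j k =
  phi x * (assoc_C H c x i j k + conormal_third_form H c x i j k)
  - 2^-1 * (pder i phi x * assoc_G H c x j k + pder j phi x * assoc_G H c x i k
            - pder k phi x * assoc_G H c x i j).
Proof.
move=> GG' Vx; rewrite (assoc_CE rH ac)// (assoc_CE rH' ac)//.
rewrite (christoffel_first_kind_scale i j k Vo Vx (dphi Vx)
  (assoc_G_differentiable rH ac Vx) GG').
move: (conormal_third_form H c x i j k) (conormal_third_form H' c x i j k).
move: (christoffel_first_kind _ _ _ _ _).
move: (pder i phi x) (pder j phi x) (pder k phi x) => *.
by ring.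
Qed.

Section SameImmersion.
Hypothesis ff' : forall p, immersion H' p = immersion H p.
Hypothesis XiXi' : forall x, conormal H' (param c x) = phi x *: conormal H (param c x).

Let f_eq : immersion H' \o param c = immersion H \o param c.
Proof. by apply/funext => x /=. Qed.

Lemma conformal_assoc_G x : V x -> assoc_G H' c x = phi x *: assoc_G H c x.
Proof.
move=> Vx; rewrite (assoc_GE rH ac)// (assoc_GE rH' ac)//.
apply/matrixP => i j; rewrite [LHS]mxE [RHS]mxE [X in _ * X]mxE f_eq.
have -> : (conormal H' \o param c) x = phi x *: (conormal H \o param c) x.
  exact: XiXi'.
by rewrite -scalemxAr [LHS]mxE.
Qed.

Lemma conformal_third_form x i j k : V x ->
  conormal_third_form H' c x i j k =
  phi x * conormal_third_form H c x i j k + pder k phi x * assoc_G H c x i j.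
Proof.
move=> Vx; rewrite /conormal_third_form f_eq.
have -> : conormal H' \o param c = (fun y => phi y *: (conormal H \o param c) y).
  by apply/funext => y /=; rewrite XiXi'.
rewrite pder_scale_mx; [|exact: dphi|exact: (entries_conormal (relative_pair rH ac))].
rewrite mulmxDr -!scalemxAr (assoc_GE rH ac)// pair_scalar !mxE eqxx mulr1n.
by rewrite addrC.
Qed.

Lemma conformal_assoc_C x i j k : V x ->
  assoc_C H' c x i j k = phi x * assoc_C H c x i j k
    - 2^-1 * sym_metric (fun a => pder a phi x) (assoc_G H c x) i j k.
Proof.
move=> Vx; have := cubic_third_form_scale i j k (@conformal_assoc_G) Vx.
rewrite conformal_third_form// /sym_metric.
move: (conormal_third_form _ _ _ _ _ _) (assoc_C H c x i j k) (assoc_C H' c x i j k).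
move: (pder i phi x) (pder j phi x) (pder k phi x) (assoc_G H c x i j).
move: (assoc_G H c x i k) (assoc_G H c x j k) (phi x) => *; lra.
Qed.

Lemma conformal_assoc_u x k : V x -> phi x != 0 ->
  assoc_u H' c x k = assoc_u H c x k - 2^-1 * (pder k phi x / phi x).
Proof.
move=> Vx phi0; rewrite /assoc_u conformal_assoc_G//.
have uG := rc_nondegenerate rH ac Vx.
rewrite invmxZ; last by rewrite unitmxZ ?unitfE.
have tr := trace_sym_metric (fun a => pder a phi x) k (assoc_G_sym rH ac Vx) uG.
have -> : \sum_i \sum_j ((phi x)^-1 *: invmx (assoc_G H c x)) i j
      * assoc_C H' c x i j k =
    \sum_i \sum_j invmx (assoc_G H c x) i j * assoc_C H c x i j k
    - (2 * phi x)^-1 * ((n%:R + 2) * pder k phi x).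
  rewrite -tr mulr_sumr -sumrB; apply: eq_bigr => i _.
  rewrite mulr_sumr -sumrB; apply: eq_bigr => j _.
  by rewrite mxE conformal_assoc_C//; field.
have n20 : n%:R + 2 != 0 :> R by rewrite lt0r_neq0// ltr_wpDl.
by move: (pder k phi x) (\sum_i _) => a b; field; rewrite phi0.
Qed.

Lemma conformal_assoc_U x i j k : V x -> phi x != 0 ->
  assoc_U H' c x i j k = phi x * assoc_U H c x i j k.
Proof.
move=> Vx phi0; rewrite /assoc_U conformal_assoc_C// !conformal_assoc_u//.
have GE a b : assoc_G H' c x a b = phi x * assoc_G H c x a b.
  by rewrite conformal_assoc_G// [LHS]mxE.
rewrite !GE /sym_metric.
have alg (p C u1 u2 u3 g1 g2 g3 a1 a2 a3 : R) : p != 0 ->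
    p * C - 2^-1 * (a1 * g1 + a2 * g2 + a3 * g3)
    - ((u1 - 2^-1 * (a1 / p)) * (p * g1) + (u2 - 2^-1 * (a2 / p)) * (p * g2)
       + (u3 - 2^-1 * (a3 / p)) * (p * g3)) =
    p * (C - (u1 * g1 + u2 * g2 + u3 * g3)).
  by move=> p0; field.
exact: alg.
Qed.

End SameImmersion.

End ConformalChange.

(** * From local to global *)

Section Global.
Context {R : realType} {n : nat}.
Variable M : manifold R n.

Lemma chart_range_coord (c : chart R n M) p : dom c p -> chart_range c (coord c p).
Proof. by move=> cp; exists p. Qed.

(** In each chart such a function is constant on balls, hence it is locally
    constant, and the manifold is connected. *)
Lemma constant_of_pder0 (h : M -> R) :
  (forall c, atlas c -> forall x, chart_range c x ->
     differentiable (h \o param c) x /\ forall i, pder i (h \o param c) x = 0) ->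
  exists a, forall p, h p = a.
Proof.
move=> dh; have [[p0 _]|noM] := pselect (exists p : M, True); last first.
  by exists 0 => p; case: noM; exists p.
have [|a|p|p a b <- <- //|a ha] :=
    @connected_gluing M R (fun a p => h p = a) p0; last by exists a.
- exact: manifold_connected.
- rewrite openE => p /= ha; have [c ac cp] := atlas_cover p.
  have cc := atlas_charts ac; have Vp := chart_range_coord cp.
  have /nbhs_ballP[r /= r0 rV] := open_nbhs_nbhs (conj (chart_range_open cc) Vp).
  apply: filterS (coord_near cc cp (nbhsx_ballx _ _ r0)) => q [cq rq] /=.
  have := @pder0_constant_ball _ _ (h \o param c) (coord c p) r.
  move=> /(_ (fun y yr => (dh c ac y (rV y yr)).1)).
  move=> /(_ (fun y i yr => (dh c ac y (rV y yr)).2 i)) /(_ _ rq) /=.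
  by rewrite !chart_coordK// ha.
- by exists (h p).
Qed.

Lemma smooth_map_differentiable (W : normedModType R) (h : M -> W) c x :
  smooth_map h -> atlas c -> chart_range c x -> differentiable (h \o param c) x.
Proof. by move=> sh ac Vx; exact: smooth_differentiable (sh c ac) Vx. Qed.

Section ConformalFactor.
Variables (Om : M -> R) (c : chart R n M).
Hypotheses (sOm : smooth_map Om) (Om0 : forall p, Om p != 0) (ac : atlas c).

Let V := chart_range c.
Definition squared_factor x : R := Om (param c x) ^+ 2.

Lemma squared_factor_gt0 x : 0 < squared_factor x.
Proof. by rewrite /squared_factor lt0r sqrf_eq0 Om0 sqr_ge0. Qed.

Lemma squared_factor_neq0 x : squared_factor x != 0.
Proof. by rewrite lt0r_neq0// squared_factor_gt0. Qed.

Lemma squared_factor_mul :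
  squared_factor = fun x => (Om \o param c) x * (Om \o param c) x.
Proof. by apply/funext => x; rewrite /squared_factor expr2. Qed.

Lemma squared_factor_differentiable x : V x -> differentiable squared_factor x.
Proof.
move=> Vx; rewrite squared_factor_mul.
by apply: differentiableM; exact: smooth_map_differentiable.
Qed.

Lemma squared_factor_pder_differentiable x k :
  V x -> differentiable (pder k squared_factor) x.
Proof.
move=> Vx; set w := Om \o param c.
have dw y : V y -> differentiable w y by exact: smooth_map_differentiable.
have dwk y : V y -> differentiable (pder k w) y.
  exact: smooth_differentiable (smooth_pder k (sOm ac)).
apply: (@differentiable_open _ _ _ _ (fun y => pder k w y * w y + w y * pder k w y)
  _ _ (chart_range_atlas_open ac) Vx).
  move=> y Vy; rewrite squared_factor_mul.
  by apply: esym; apply: pder_scalar_mul; exact: dw.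
by apply: differentiableD; apply: differentiableM;
  [exact: dwk|exact: dw|exact: dw|exact: dwk].
Qed.

Lemma ln_norm_sqr (a : R) : ln `|a| = 2^-1 * ln (a ^+ 2).
Proof.
have [->|a0] := eqVneq a 0; first by rewrite normr0 expr0n/= ln0// mulr0.
by rewrite -real_normK ?num_real// lnXn ?normr_gt0//; field.
Qed.

Lemma ln_factor_pder x : V x ->
  differentiable (fun y => ln `|Om (param c y)|) x /\
  forall k, pder k (fun y => ln `|Om (param c y)|) x
    = 2^-1 * (pder k squared_factor x / squared_factor x).
Proof.
move=> Vx.
have -> : (fun y => ln `|Om (param c y)|) = (fun y => 2^-1 * ln (squared_factor y)).
  by apply/funext => y; rewrite ln_norm_sqr.
have [dln lnE] := pder_ln (squared_factor_differentiable Vx) (squared_factor_gt0 x).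
have d2 : differentiable (cst (2^-1 : R)) x by exact: differentiable_cst.
split=> [|k]; first exact: (differentiableM d2 dln).
apply: etrans (pder_scalar_mul k d2 dln) _.
by rewrite lnE /pder derive_cst mul0r add0r.
Qed.

End ConformalFactor.

(** The gradient of [t' - t + 3 ln |Omega|] is [3 (u' - u + d ln |Omega|)], which
    vanishes; the constant value of this function is the shift of [t]. *)
Lemma conformal_data_of_conormal (H H' : conormalisation M) (D D' : structure_data M) :
  is_relative_conormalisation H -> is_relative_conormalisation H' ->
  conormal_conformal H H' -> associated D H -> associated D' H' ->
  exists a a' : R,
    abundant_conformal (shift_potential D a) (shift_potential D' a').
Proof.
move=> rH rH' [ff' [Om [sOm Om0 XiXi']]] [tD DH] [tD' DH'].
have dphi c (ac : atlas c) x : chart_range c x ->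
    differentiable (squared_factor Om c) x.
  exact: squared_factor_differentiable.
pose h p := potential D' p - potential D p + 3 * ln `|Om p|.
have [c ac x Vx|a ha] := @constant_of_pder0 h.
  have dt := smooth_map_differentiable tD ac Vx.
  have dt' := smooth_map_differentiable tD' ac Vx.
  have [dl lE] := ln_factor_pder sOm Om0 ac Vx.
  have d3 : differentiable (cst (3 : R)) x by exact: differentiable_cst.
  have dh : differentiable (h \o param c) x.
    exact: differentiableD (differentiableB dt' dt) (differentiableM d3 dl).
  split=> // k.
  have hE : pder k (h \o param c) x = pder k (potential D' \o param c) x
      - pder k (potential D \o param c) x
      + pder k (fun y => 3 * ln `|Om (param c y)|) x.
    apply: etrans (deriveD _ _) _; first exact/diff_derivable/differentiableB.
      exact/diff_derivable/(differentiableM d3 dl).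
    by congr (_ + _); apply: deriveB; exact: diff_derivable.
  have [_ _ uD] := DH c ac x Vx; have [_ _ uD'] := DH' c ac x Vx.
  have u' := conformal_assoc_u rH rH' ac (dphi c ac) ff' (fun y => XiXi' (param c y))
    k Vx (squared_factor_neq0 c Om0 x).
  have l3 : pder k (fun y => 3 * ln `|Om (param c y)|) x =
      3 * (2^-1 * (pder k (squared_factor Om c) x / squared_factor Om c x)).
    apply: etrans (pder_scalar_mul k d3 dl) _.
    by rewrite lE /pder derive_cst mul0r add0r.
  have alg (a b d : R) : 3^-1 * a = 3^-1 * b - 2^-1 * d -> a - b + 3 * (2^-1 * d) = 0.
    by lra.
  rewrite hE l3; apply: alg.
  apply: etrans (esym (uD' k)) _; apply: etrans u' _.
  exact: (congr1 (fun z => z - _) (uD k)).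
exists a, 0, Om; split=> //=.
- move=> c ac x Vx; have [GD _ _] := DH c ac x Vx; have [GD' _ _] := DH' c ac x Vx.
  rewrite -GD -GD'.
  exact: (conformal_assoc_G rH rH' ac ff' (fun y => XiXi' (param c y)) Vx).
- move=> c ac x Vx i j k; have [GD UD _] := DH c ac x Vx.
  have [GD' UD' _] := DH' c ac x Vx.
  have phi0 := squared_factor_neq0 c Om0 x.
  have UE := conformal_assoc_U rH rH' ac (dphi c ac) ff' (fun y => XiXi' (param c y))
    _ _ _ Vx phi0.
  have GE := conformal_assoc_G rH rH' ac ff' (fun y => XiXi' (param c y)) Vx.
  have SE l : cubic D' c x i j l = squared_factor Om c x * cubic D c x i j l.
    have := UE i j l; rewrite UD UD' => E.
    by apply: (mulfI (_ : 3^-1 != 0 :> R)); rewrite ?invr_eq0 ?pnatr_eq0// E mulrCA.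
  apply: eq_bigr => l _; rewrite SE -GD' GE -GD invmxZ; last first.
    by rewrite unitmxZ ?unitfE//; exact: rc_nondegenerate rH c ac x Vx.
  by rewrite [X in _ * X]mxE mulrACA mulfV// mul1r.
- move=> p; have := ha p; rewrite /h addr0.
  have alg (s t l z : R) : s - t + l = z -> s = t + z - l by lra.
  exact: alg.
Qed.

(** Differentiating the constraint once and twice shows that [w] annihilates the
    vectors that span the ambient space. This is what makes the affine map
    relating two immersions unique. *)
Lemma linear_constraint_trivial (V W : set 'rV[R]_n) f Xi q
    (w : 'M[R]_(n + 1, q)) d x :
  (0 < n)%N -> open V -> nondegenerate_pair V f Xi -> open W -> W `<=` V -> W x ->
  (forall y, W y -> f y *m w = d) -> w = 0.
Proof.
move=> n0 Vo fXi Wo WV Wx fw.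
have cw (y : 'rV[R]_n) : entries_differentiable (cst w) y.
  by move=> a b; exact: differentiable_cst.
have wz y i : pder i (cst w : 'rV[R]_n -> _) y = 0 by rewrite /pder derive_cst.
have first j y : W y -> pder j f y *m w = 0.
  move=> Wy; have df : entries_differentiable f y.
    exact/differentiable_entries/(pair_differentiable fXi)/WV.
  have := pder_mulmx j df (cw y); rewrite wz mulmx0 addr0 => <-.
  by rewrite (pder_open (k := cst d) j Wo Wy)//; rewrite /pder derive_cst.
apply: (osculating_kernel Vo fXi n0 (WV _ Wx)) => [|i j].
  apply/row_matrixP => j; rewrite (row_jacobian_mul fXi) ?row0; last exact: WV.
  exact: first.
have := pder_mulmx i (entries_pder_immersion fXi j (WV _ Wx)) (cw x).
rewrite wz mulmx0 addr0 => <-.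
by rewrite (pder_open (k := cst 0) i Wo Wx) ?/pder ?derive_cst// => y Wy; exact: first.
Qed.

(** [hat] loses no information: lowering the index again recovers the tensor.
    Equality of the raised cubics thus compares the cubics themselves. *)
Lemma hat_lower (g : 'M[R]_n) (S : tensor3 R n) i j l : g \in unitmx ->
  \sum_k hat g S i j k * g k l = S i j l.
Proof.
move=> ug; pose v := \row_k S i j k.
have := mulmxKV ug v => /matrixP/(_ 0 l); rewrite !mxE => <-.
apply: eq_bigr => k _; congr (_ * _); rewrite mxE.
by apply: eq_bigr => m _; rewrite mxE.
Qed.

Section Congruence.
Variables (D D' : structure_data M) (H H' : conormalisation M) (Om : M -> R).
Hypotheses (n1 : (1 < n)%N) (rH : is_relative_conormalisation H)
  (rH' : is_relative_conormalisation H').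
Hypotheses (DH : associated D H) (DH' : associated D' H').
Hypotheses (sOm : smooth_map Om) (Om0 : forall p, Om p != 0).
Hypothesis metric_conformal : forall c, atlas c -> forall x, chart_range c x ->
  metric D' c x = Om (param c x) ^+ 2 *: metric D c x.
Hypothesis hat_conformal : forall c, atlas c -> forall x, chart_range c x ->
  forall i j k, hat (metric D' c x) (cubic D' c x) i j k =
                hat (metric D c x) (cubic D c x) i j k.
Hypothesis potential_conformal : forall p,
  potential D' p = potential D p - 3 * ln `|Om p|.

Section InChart.
Variable c : chart R n M.
Hypothesis ac : atlas c.
Let V := chart_range c.
Let phi := squared_factor Om c.
Let f := immersion H \o param c.
Let Xi := conormal H \o param c.
Let f' := immersion H' \o param c.
Let Xi' := conormal H' \o param c.

Let dphi x : V x -> differentiable phi x.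
Proof. exact: squared_factor_differentiable. Qed.

Let phi0 x : phi x != 0.
Proof. exact: squared_factor_neq0. Qed.

Lemma conformal_data_G x : V x -> assoc_G H' c x = phi x *: assoc_G H c x.
Proof.
move=> Vx; have [-> _ _] := DH.2 c ac x Vx; have [-> _ _] := DH'.2 c ac x Vx.
exact: metric_conformal.
Qed.

Lemma conformal_data_U x i j k : V x ->
  assoc_U H' c x i j k = phi x * assoc_U H c x i j k.
Proof.
move=> Vx; have [GD -> _] := DH.2 c ac x Vx; have [GD' -> _] := DH'.2 c ac x Vx.
have uD : metric D c x \in unitmx by rewrite -GD; exact: rc_nondegenerate rH c ac x Vx.
have uD' : metric D' c x \in unitmx.
  by rewrite -GD'; exact: rc_nondegenerate rH' c ac x Vx.
rewrite mulrCA -(hat_lower (cubic D c x) i j k uD).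
rewrite -(hat_lower (cubic D' c x) i j k uD').
congr (_ * _); rewrite mulr_sumr; apply: eq_bigr => l _.
by rewrite hat_conformal// mulrCA; congr (_ * _); rewrite metric_conformal// [LHS]mxE.
Qed.

Lemma conformal_data_u x k : V x ->
  assoc_u H' c x k = assoc_u H c x k - 2^-1 * (pder k phi x / phi x).
Proof.
move=> Vx; have [_ _ ->] := DH.2 c ac x Vx; have [_ _ ->] := DH'.2 c ac x Vx.
have dt := smooth_map_differentiable DH.1 ac Vx.
have [dl lE] := ln_factor_pder sOm Om0 ac Vx.
have d3 : differentiable (cst (3 : R)) x by exact: differentiable_cst.
have tE : potential D' \o param c = (potential D \o param c)
    - (fun y => 3 * ln `|Om (param c y)|).
  by apply/funext => y; exact: potential_conformal.
have l3 : pder k (fun y => 3 * ln `|Om (param c y)|) x =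
    3 * (2^-1 * (pder k phi x / phi x)).
  apply: etrans (pder_scalar_mul k d3 dl) _.
  by rewrite lE /pder derive_cst mul0r add0r.
have t'E : pder k (potential D' \o param c) x = pder k (potential D \o param c) x
    - 3 * (2^-1 * (pder k phi x / phi x)).
  rewrite tE; apply: etrans (deriveB _ _) _.
  - exact: diff_derivable.
  - exact/diff_derivable/(differentiableM d3 dl).
  - by congr (_ - _); exact: l3.
have alg (a z : R) : 3^-1 * (a - 3 * z) = 3^-1 * a - z by field.
by rewrite /grad_form t'E; exact: alg.
Qed.

(** The cubic form is reassembled from its trace and its trace-free part, whose
    conformal behaviour is prescribed. *)
Lemma conformal_data_C x i j k : V x ->
  assoc_C H' c x i j k = phi x * assoc_C H c x i j k
    - 2^-1 * sym_metric (fun a => pder a phi x) (assoc_G H c x) i j k.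
Proof.
move=> Vx; have := conformal_data_U i j k Vx; rewrite /assoc_U.
have GE a b : assoc_G H' c x a b = phi x * assoc_G H c x a b.
  by rewrite conformal_data_G// [LHS]mxE.
rewrite !conformal_data_u// !GE /sym_metric.
have alg (C' p C u1 u2 u3 g1 g2 g3 a1 a2 a3 : R) : p != 0 ->
    C' - ((u1 - 2^-1 * (a1 / p)) * (p * g1) + (u2 - 2^-1 * (a2 / p)) * (p * g2)
       + (u3 - 2^-1 * (a3 / p)) * (p * g3)) =
    p * (C - (u1 * g1 + u2 * g2 + u3 * g3)) ->
    C' = p * C - 2^-1 * (a1 * g1 + a2 * g2 + a3 * g3).
  by move=> p0 /eqP; rewrite subr_eq => /eqP ->; field.
exact: alg.
Qed.

(** Given the conformal behaviour of the cubic forms, the Christoffel terms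
    cancel, and [f'] pairs with the derivatives of [Xi'] as [f] pairs with those
    of [phi Xi]. *)
Lemma conformal_data_third_form x i j k : V x ->
  conormal_third_form H' c x i j k =
  phi x * conormal_third_form H c x i j k + pder k phi x * assoc_G H c x i j.
Proof.
move=> Vx; have := cubic_third_form_scale rH rH' ac dphi i j k conformal_data_G Vx.
rewrite conformal_data_C// /sym_metric.
move: (conormal_third_form _ _ _ _ _ _) (assoc_C H c x i j k) => T C.
move: (pder i phi x) (pder j phi x) (pder k phi x) (assoc_G H c x i j).
move: (assoc_G H c x i k) (assoc_G H c x j k) (phi x) => *; lra.
Qed.

(** The dual frame of the rescaled co-normal [phi Xi]. *)
Let Z y : 'M[R]_(n + 1) :=
  phi y *: dual_frame Xi y + row_mx (Xi y *m \row_k pder k phi y) 0.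

Let mul_Z q (B : 'M[R]_(q, n + 1)) y : B *m Z y =
  phi y *: (B *m dual_frame Xi y) + row_mx (B *m Xi y *m \row_k pder k phi y) 0.
Proof.
rewrite /Z mulmxDr -scalemxAr; congr (_ + _).
by rewrite mul_mx_row mulmx0 mulmxA.
Qed.

Lemma second_dual_frame (K : conormalisation M) x i j :
  is_relative_conormalisation K -> V x ->
  pder i (pder j (immersion K \o param c)) x *m dual_frame (conormal K \o param c) x
  = row_mx (\row_k conormal_third_form K c x i j k) (assoc_G K c x i j)%:M.
Proof.
move=> rK Vx; rewrite mul_mx_row pair_scalar -(assoc_GE rK ac)//; congr row_mx.
apply/rowP => k; rewrite [RHS]mxE [LHS]mxE /conormal_third_form [RHS]mxE.
by apply: eq_bigr => a _; rewrite [X in _ * X]mxE.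
Qed.

Lemma conformal_data_local_congruence x : V x ->
  exists (A : 'M[R]_(n + 1)) (b : 'rV[R]_(n + 1)), A \in unitmx /\
    \forall y \near x, f' y = f y *m A + b /\ A *m Xi' y = phi y *: Xi y.
Proof.
have Vo : open V := chart_range_atlas_open ac.
have fXi := relative_pair rH ac; have fXi' := relative_pair rH' ac.
move=> Vx; have [|y Vy|y Vy i j|A [b [uA near_x]]] :=
    @local_rigidity R n V f f' Xi Xi' Z Vo n1 fXi fXi' _ _ _ x Vx.
- move=> y Vy a b; rewrite /Z.
  under [X in differentiable X _]eq_fun do rewrite !mxE.
  apply: differentiableD.
    apply: differentiableM; first exact: dphi.
    case: (fintype.split b) => k; last exact: (entries_conormal fXi).
    under [X in differentiable X _]eq_fun do rewrite mxE.
    apply: differentiable_entries.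
    exact: smooth_differentiable (smooth_pder k (np_conormal_smooth fXi)) Vy.
  case: (fintype.split b) => k; last first.
    by under [X in differentiable X _]eq_fun do rewrite mxE.
  under [X in differentiable X _]eq_fun do rewrite mxE.
  apply: differentiable_fun_sum => l; apply: differentiableM.
    exact: (entries_conormal fXi).
  under [X in differentiable X _]eq_fun do rewrite mxE.
  exact: squared_factor_pder_differentiable.
- apply: etrans (mul_Z _ _) _.
  apply: etrans _ (esym (jacobian_dual_frame Vo fXi' Vy)).
  have GE : - second_form f' Xi' y = phi y *: - second_form f Xi y.
    rewrite scalerN -(assoc_GE rH ac Vy) -(assoc_GE rH' ac Vy).
    by rewrite conformal_data_G.
  have J0 := np_tangent fXi Vy; have JK := jacobian_dual_frame Vo fXi Vy.
  by rewrite J0 JK GE mul0mx row_mx0 addr0 scale_row_mx scaler0.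
- apply: etrans (mul_Z _ _) _; apply: etrans _ (esym (second_dual_frame i j rH' Vy)).
  have K := second_dual_frame i j rH Vy.
  have G : pder i (pder j f) y *m Xi y = (assoc_G H c y i j)%:M.
    by rewrite pair_scalar (assoc_GE rH ac Vy).
  rewrite K G scale_row_mx add_row_mx addr0 mul_scalar_mx; congr row_mx.
    apply/rowP => k.
    transitivity (phi y * conormal_third_form H c y i j k
                  + assoc_G H c y i j * pder k phi y).
      by rewrite !mxE.
    by rewrite [RHS]mxE conformal_data_third_form// [X in _ + X]mulrC.
  by rewrite conformal_data_G// scale_scalar_mx; congr (_%:M); rewrite [RHS]mxE.
- exists A, b; split=> //; apply: filterS near_x => y [-> ->]; split=> //.
  by rewrite /Z linearD/= linearZ/= /dual_frame !row_mxKr addr0.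
Qed.

End InChart.

(** The local affine maps are unique, so they agree on the connected manifold. *)
Lemma conformal_data_congruence :
  exists (A : 'M[R]_(n + 1)) (b : 'rV[R]_(n + 1)), A \in unitmx /\
  forall p, immersion H' p = immersion H p *m A + b /\
            A *m conormal H' p = Om p ^+ 2 *: conormal H p.
Proof.
have [[p0 _]|noM] := pselect (exists p : M, True); last first.
  by exists 1%:M, 0; split=> [|p]; [exact: unitmx1|case: noM; exists p].
pose Q (Ab : 'M[R]_(n + 1) * 'rV[R]_(n + 1)) p :=
  immersion H' p = immersion H p *m Ab.1 + Ab.2 /\
  Ab.1 *m conormal H' p = Om p ^+ 2 *: conormal H p.
pose P (Ab : 'M[R]_(n + 1) * 'rV[R]_(n + 1)) (p : M) :=
  Ab.1 \in unitmx /\ \forall q \near p, Q Ab q.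
have [|Ab|p|p [A b] [A2 b2] [uA PA] [uA2 PA2]|[A b] PAb] :=
    @connected_gluing M _ P p0.
- exact: manifold_connected.
- rewrite openE => p /= [uA /near_join PA].
  by apply: filterS PA => q Qq; split.
- have [c ac cp] := atlas_cover p; have cc := atlas_charts ac.
  have [A [b [uA nA]]] := conformal_data_local_congruence ac (chart_range_coord cp).
  exists (A, b); split=> //.
  apply: filterS (coord_near cc cp nA) => q [cq].
  by rewrite /= /squared_factor !chart_coordK.
- have [c ac cp] := atlas_cover p; have cc := atlas_charts ac.
  have Vo := chart_range_atlas_open ac; have Vp := chart_range_coord cp.
  have fXi := relative_pair rH ac.
  have nW : \forall y \near coord c p,
      chart_range c y /\ (Q (A, b) (param c y) /\ Q (A2, b2) (param c y)).
    apply: filterI; first exact: (open_nbhs_nbhs (conj Vo Vp)).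
    by apply: filterI; apply: param_near.
  have AE : A - A2 = 0.
    have Wp := nbhs_singleton (nbhs_interior nW).
    apply: (linear_constraint_trivial (d := b2 - b) (ltnW n1) Vo fXi
      (@open_interior _ _) _ Wp).
      by move=> y /interior_subset [].
    move=> y /interior_subset [Vy [[/= E _] [/= E2 _]]].
    rewrite mulmxBr /=; apply/eqP; rewrite subr_eq addrAC eq_sym subr_eq addrC.
    by rewrite -E -E2.
  have AA : A = A2 by apply/eqP; rewrite -subr_eq0 AE.
  move: PA PA2 => /nbhs_singleton[/= E _] /nbhs_singleton[/= E2 _].
  by move: E; rewrite E2 AA => /addrI ->.
- by exists A, b; split=> [|p]; [have [] := PAb p0|have [_ /nbhs_singleton] := PAb p].
Qed.

End Congruence.

End Global.

Theorem theorem4 (R : realType) (n : nat) (M : manifold R n)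
    (hn : (3 <= n)%N) (hM : simply_connected R M) :
  (forall (D D' : structure_data M) (H H' : conormalisation M),
     is_abundant_manifold D -> is_abundant_manifold D' ->
     abundant_conformal D D' ->
     is_abundant_conormalisation H -> is_abundant_conormalisation H' ->
     associated D H -> associated D' H' ->
     exists (A : 'M[R]_(n + 1)) (b : 'rV[R]_(n + 1)),
       A \in unitmx /\ conormal_conformal H (affine_image A b H'))
  /\
  (forall (H H' : conormalisation M) (D D' : structure_data M),
     is_abundant_conormalisation H -> is_abundant_conormalisation H' ->
     conormal_conformal H H' ->
     associated D H -> associated D' H' ->
     exists a a' : R,
       abundant_conformal (shift_potential D a) (shift_potential D' a')).
Proof.
split.
- move=> D D' H H' _ _ [Om [sOm Om0 gg' hh' tt']] aH aH' DH DH'.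
  have [A [b [uA AE]]] := conformal_data_congruence
    (ltnW hn) (ac_relative aH) (ac_relative aH') DH DH' sOm Om0 gg' hh' tt'.
  (* [A] carries the immersion of [H] to that of [H'], so the affine map applied
     to [H'] is its inverse. *)
  exists (invmx A), (- (b *m invmx A)); split; first by rewrite unitmx_inv.
  split=> [p|].
    by rewrite /= (AE p).1 mulmxDl mulmxK// addrK.
  by exists Om; split=> // p; rewrite /= invmxK (AE p).2.
- move=> H H' D D' aH aH' HH'.
  exact: conformal_data_of_conormal (ac_relative aH) (ac_relative aH') HH'.
Qed.
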